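(* Assume that the function $A$ is increasing on $[0,1]$. A necessary and sufficient condition for the existence of cumulative distribution functions $F_\infty$ on $\mathbb{R}$ solving the stationary equation $$\tfrac12\partial_x^2\big(A(F_\infty(x))\big)-\partial_x\big(B(F_\infty(x))\big)=0$$ in the sense of distributions is that $B(1)=0$, $B(u)\ge0$ for all $u\in[0,1]$, and the function $a/(2B)$ is locally integrable on $(0,1)$. Then all the solutions are continuous. If in addition $B(u)>0$ for all $u\in(0,1)$, then $F_\infty$ is a solution if and only if there exists $\bar{x}\in\mathbb{R}$ such that for all $x\in\mathbb{R}$, $F_\infty(x)=\Psi^{-1}(x+\bar{x})$, where the function $\Psi$ is defined by $$\forall u\in(0,1),\qquad \Psi(u):=\int_{1/2}^u\frac{a(v)}{2B(v)}\,\mathrm{d}v.$$ In this case, $\bar{x}=\Psi(F_\infty(0))$.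
   Context: Let $a,b : [0,1] \to \mathbb{R}$ be continuous functions with $a \geq 0$; for $u\in[0,1]$ set $A(u) = \int_0^u a(v)\,\mathrm{d}v$ and $B(u) = \int_0^u b(v)\,\mathrm{d}v$. The convention $a(u)/(2B(u))=0$ is used when $a(u)=B(u)=0$. $\Psi^{-1}$ denotes the inverse of the continuous increasing function $\Psi$; in case $\Psi$ has a finite limit at $1$, denoted $\Psi(1)$ (resp. at $0$, denoted $\Psi(0)$), one sets $\Psi^{-1}(x)=1$ for $x\ge\Psi(1)$ (resp. $\Psi^{-1}(x)=0$ for $x\le\Psi(0)$), so that $\Psi^{-1}$ is a cumulative distribution function on $\mathbb{R}$.
   Formalization: The final identity x̄ = Ψ(F∞(0)) is stated only for Ψ(0) ≤ x̄ ≤ Ψ(1) (limits in the extended reals), since it fails when a finite limit of Ψ is exceeded, e.g. a = u(1−u), b = 1−2u, x̄ = 5. *)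

(* Defs.v *)
From HB Require Import structures.
From mathcomp Require Import all_boot all_order all_algebra.
From mathcomp Require Import all_classical all_reals all_analysis.
Set Implicit Arguments.
Unset Strict Implicit.
Unset Printing Implicit Defensive.
Import Order.TTheory GRing.Theory Num.Theory.
Import numFieldNormedType.Exports.
Local Open Scope classical_set_scope.
Local Open Scope ring_scope.

Definition is_cdf (R : realType) (F : R -> R) : Prop :=
  exists G : cumulativeBounded (0 : R) (1 : R), F =1 G.

Definition test_function (R : realType) (phi : R -> R) : Prop :=
  (forall (n : nat) (x : R), derivable (phi^`(n))%classic x 1) /\
  compact (closure [set x | phi x != 0]).

(* Distributions are represented as functionals on all of R -> R; only their
   values on test functions are meaningful, and test functions are stable under
   derivation. *)
Definition distribution_of (R : realType) (f phi : R -> R) : R :=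
  \int[lebesgue_measure]_x (f x * phi x).

Definition distribution_deriv (R : realType) (T : (R -> R) -> R)
    (phi : R -> R) : R :=
  - T (phi^`())%classic.

Definition primitive (R : realType) (f : R -> R) (u : R) : R :=
  \int[lebesgue_measure]_(v in `[0, u]) f v.

Definition stationary (R : realType) (a b F : R -> R) : Prop :=
  forall phi : R -> R, test_function phi ->
    2^-1 * distribution_deriv
             (distribution_deriv (distribution_of (primitive a \o F))) phi
    - distribution_deriv (distribution_of (primitive b \o F)) phi = 0.

Definition stationary_cdf (R : realType) (a b F : R -> R) : Prop :=
  is_cdf F /\ stationary a b F.

(* The quotient is taken in the extended reals, where r%:E / 0 is 0 if r = 0
   and +oo if 0 < r: this gives the convention 0 / 0 = 0, while a / (2 B) is
   infinite where B vanishes and a does not. *)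
Definition stationary_ratio (R : realType) (a b : R -> R) (u : R) : \bar R :=
  ((a u)%:E / (2 * primitive b u)%:E)%E.

(* lebesgue_integral_differentiation.locally_integrable is restricted to
   real-valued functions, and would lose the value +oo of the ratio. *)
Definition locally_integrable_ereal (R : realType) (D : set R)
    (f : R -> \bar R) : Prop :=
  forall K : set R, K `<=` D -> compact K ->
    lebesgue_measure.-integrable K f.

Definition existence_condition (R : realType) (a b : R -> R) : Prop :=
  [/\ primitive b 1 = 0,
      forall u : R, 0 <= u <= 1 -> 0 <= primitive b u &
      locally_integrable_ereal `]0, 1[ (stationary_ratio a b)].

Definition Psi (R : realType) (a b : R -> R) (u : R) : R :=
  if 2^-1 <= u
  then fine (\int[lebesgue_measure]_(v in `[2^-1%R, u])
               stationary_ratio a b v)%E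
  else - fine (\int[lebesgue_measure]_(v in `[u, 2^-1%R])
                 stationary_ratio a b v)%E.

Definition lim_at_0 (R : realType) (G : R -> R) : \bar R :=
  lim ((G u)%:E @[u --> 0^'+]).

Definition lim_at_1 (R : realType) (G : R -> R) : \bar R :=
  lim ((G u)%:E @[u --> 1^'-]).

(* For G continuous increasing on ]0, 1[: the inverse of G there, extended by 1
   above the limit of G at 1 and by 0 below its limit at 0. A limit +oo
   at 1, or -oo at 0, makes the corresponding test fail for every x. *)
Definition extended_inverse (R : realType) (G : R -> R) (x : R) : R :=
  if (lim_at_1 G <= x%:E)%E then 1
  else if (x%:E <= lim_at_0 G)%E then 0
  else 'pinv_(fun=> 0) `]0, 1[ G x.

(* Main.v *)
Require Import Defs.
From HB Require Import structures.
From mathcomp Require Import all_boot all_order all_algebra.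
From mathcomp Require Import all_classical all_reals all_analysis.
From mathcomp Require Import measurable_realfun ring lra.
Import Order.TTheory GRing.Theory Num.Theory.
Import numFieldNormedType.Exports.
Set Implicit Arguments.
Unset Strict Implicit.
Unset Printing Implicit Defensive.
Local Open Scope classical_set_scope.
Local Open Scope ring_scope.

(** The stationary equation integrates once. Write [A], [B] for the primitives
    of [a], [b]. In the sense of distributions, [(A(F)' / 2 - B(F))' = 0], so
    that [A(F)' = 2 B(F) + c] for a constant [c].

    The weak equation is only tested on smooth functions with compact support,
    so this step starts from the construction of such functions, out of the flat
    functions [x ^- k * exp (- 1 / x)] ([smooth_ramp]). A test function whose
    second derivative concentrates at four points yields, at the limit,
    [A(F y) - A(F x) = 2 * \int_x^y B(F) + c * (y - x)] for all [x < y]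
    ([weak_to_integral]): the mollifiers sit to the right of the points, and
    [A(F)] is right-continuous. Hence [A(F)] is Lipschitz; [A] being continuous
    and strictly increasing, [F] is continuous, and [A(F)] has the continuous
    derivative [2 B(F) + c]. Since [A(F)] is bounded and its derivative has
    limits [c] and [2 B(1) + c] at the two infinities, both are zero: [c = 0]
    and [B(1) = 0] ([stationary_classical]). Since [A(F)] is nondecreasing and
    [F] takes all the values in [(0, 1)], [B >= 0]. Conversely, [A(F)' = 2 B(F)]
    gives back the weak equation by parts ([classical_stationary]).

    In the variable [u = F(x)] the equation [A(F)' = 2 B(F)] reads
    [dx = a(u) / (2 B(u)) du = dPsi(u)]. Neither [F] nor [A^-1] need be
    differentiable, as [a] may vanish; the change of variables is therefore made
    on increments, with mean values ([mean_value_derive]): the increments of one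
    function are those of the other times a value of a continuous factor. With
    [2 B] replaced by [max (2 B) e], this bounds the integral of
    [a / max (2 B) e] over [[F x, F y]] by [y - x], and [e -> 0] gives local
    integrability by monotone convergence ([stationary_locally_integrable]);
    where [B > 0], no cutoff is needed and [Psi(F y) - Psi(F x) = y - x]
    ([Psi_along_solution]), which identifies [F] as a translate of the inverse
    of [Psi]. In the other direction, under the existence condition
    [A w - A u = 2 B(z) (Psi w - Psi u)] for some [z] between [u] and [w]
    ([Psi_increment]); so [Psi] is strictly increasing, and the translates of
    its extended inverse satisfy [A(F)' = 2 B(F)]
    ([generalized_inverse_classical]). They are handled through the comparisons
    [u <= F x <-> Psi u <= x + c] and [F x <= u <-> x + c <= Psi u], which
    characterize them ([generalized_inverse_unique]). *)

(** * Real functions of one variable *)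

Section Calculus.
Context {R : realType}.
Implicit Types (f g : R -> R) (x y : R).

Lemma is_derive_continuous f g : (forall x : R, is_derive x 1 f (g x)) ->
  continuous f.
Proof.
move=> fg x; have := fg x => -[dfx _].
exact/differentiable_continuous/derivable1_diffP.
Qed.

Lemma MVT_real f g x y : (forall z : R, is_derive z 1 f (g z)) -> x <= y ->
  exists2 z, x <= z <= y & f y - f x = g z * (y - x).
Proof.
move=> fg xy; have cf := is_derive_continuous fg.
have [z zxy ->] := MVT_segment xy (fun z _ => fg z)
  (continuous_subspaceT cf).
by exists z => //; rewrite (itvP zxy).
Qed.

Lemma is_deriveM_real f g x a b : is_derive x 1 f a -> is_derive x 1 g b ->
  is_derive x 1 (fun t => f t * g t) (f x * b + g x * a).
Proof. by move=> fa gb; exact: is_deriveM. Qed.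

Lemma is_deriveD_real f g x a b : is_derive x 1 f a -> is_derive x 1 g b ->
  is_derive x 1 (fun t => f t + g t) (a + b).
Proof. by move=> fa gb; exact: is_deriveD. Qed.

Lemma is_deriveZ_real f c x a : is_derive x 1 f a ->
  is_derive x 1 (fun t => c * f t) (c * a).
Proof. by move=> fa; exact: is_deriveZ. Qed.

Lemma is_derive_affine f c d x a : is_derive (c * x + d) 1 f a ->
  is_derive x 1 (fun t => f (c * t + d)) (a * c).
Proof.
move=> fa; apply: (@is_derive1_comp _ f (fun t => c * t + d)) => //.
have h := @is_deriveZ_real id c x 1 (is_derive_id x 1).
have := is_deriveD_real h (is_derive_cst d x 1).
by rewrite mulr1 addr0.
Qed.

End Calculus.

(** * Smooth functions *)

Section Smooth.
Context {R : realType}.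
Implicit Types (f g : R -> R) (x y : R).

(** Existence of the derivatives up to order [n.+1]; derivatives are taken from
    the inside so that closure under products is a plain induction on [n]. *)
Fixpoint nderivable (n : nat) f : Prop :=
  (forall x, derivable f x 1) /\
  if n is m.+1 then nderivable m (f^`())%classic else True.

Definition smooth f := forall n, nderivable n f.

Lemma nderivableS n f g : (forall x : R, is_derive x 1 f (g x)) ->
  nderivable n.+1 f <-> nderivable n g.
Proof.
move=> fg; have -> : g = (f^`())%classic.
  by apply/funext => x; rewrite derive1E; have [_ ->] := fg x.
by split=> [[]//|?]; split=> // x; have [] := fg x.
Qed.

Lemma nderivable0 f g : (forall x : R, is_derive x 1 f (g x)) -> nderivable 0 f.
Proof. by move=> fg; split=> // x; have [] := fg x. Qed.

Lemma nderivable_is_derive n f : nderivable n f ->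
  forall x : R, is_derive x 1 f (f^`()%classic x).
Proof.
move=> nf x; have df : derivable f x 1 by case: n nf => [|n] [].
by rewrite derive1E; exact: DeriveDef.
Qed.

Lemma smooth_is_derive f g : (forall x : R, is_derive x 1 f (g x)) ->
  smooth f <-> smooth g.
Proof.
move=> fg; split=> [sf n|sg [|n]].
- by have := sf n.+1; rewrite (nderivableS n fg).
- exact: nderivable0 fg.
- by rewrite (nderivableS n fg).
Qed.

Lemma smooth_derive1n f : smooth f ->
  forall n x, derivable (f^`(n))%classic x 1.
Proof.
move=> sf n; elim: n f sf => [|n IHn] f sf x.
  by rewrite derive1n0; case: (sf 0%N).
rewrite derive1Sn; apply: IHn.
exact/(smooth_is_derive (nderivable_is_derive (sf 0%N))).
Qed.

Lemma nderivableW n f : nderivable n.+1 f -> nderivable n f.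
Proof. by elim: n f => [|n IHn] f [df nf]; split=> //; exact: IHn. Qed.

Lemma nderivableD n f g : nderivable n f -> nderivable n g ->
  nderivable n (fun x => f x + g x).
Proof.
elim: n f g => [|n IHn] f g nf ng;
  have dfg x := is_deriveD_real (nderivable_is_derive nf x)
                                (nderivable_is_derive ng x).
  exact: nderivable0 dfg.
by rewrite (nderivableS n dfg); apply: IHn; [case: nf | case: ng].
Qed.

Lemma nderivableZ n c f : nderivable n f -> nderivable n (fun x => c * f x).
Proof.
elim: n f => [|n IHn] f nf;
  have df x := is_deriveZ_real c (nderivable_is_derive nf x).
  exact: nderivable0 df.
by rewrite (nderivableS n df); apply: IHn; case: nf.
Qed.

Lemma nderivableM n f g : nderivable n f -> nderivable n g ->
  nderivable n (fun x => f x * g x).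
Proof.
elim: n f g => [|n IHn] f g nf ng;
  have dfg x := is_deriveM_real (nderivable_is_derive nf x)
                                (nderivable_is_derive ng x).
  exact: nderivable0 dfg.
rewrite (nderivableS n dfg); apply: nderivableD; apply: IHn.
- exact: nderivableW.
- by case: ng.
- exact: nderivableW.
- by case: nf.
Qed.

Lemma smooth_affine f c d : smooth f -> smooth (fun x => f (c * x + d)).
Proof.
move=> sf n; elim: n f {sf}(sf n) => [|n IHn] f nf;
  have df x := is_derive_affine (nderivable_is_derive nf (c * x + d)).
  exact: nderivable0 df.
rewrite (nderivableS n df).
have -> : (fun x => (f^`())%classic (c * x + d) * c) =
          (fun x => c * (f^`())%classic (c * x + d)).
  by apply/funext => x; rewrite mulrC.
by apply/nderivableZ/IHn; case: nf.
Qed.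

(** The functions [x ^- k * exp (- 1 / x)], extended by zero to the left of the
    origin. The derivative of one of them is a combination of the next two,
    which makes all of them smooth. *)
Definition flat (k : nat) x : R :=
  if 0 < x then x^-1 ^+ k * expR (- x^-1) else 0.

Lemma flatS k x : flat k x = flat k.+1 x * x.
Proof.
rewrite /flat; case: ifPn => [x0|_]; last by rewrite mul0r.
rewrite exprSr; set p := _ ^+ k; set e := expR _.
by rewrite -!mulrA [e * x]mulrC mulKf ?gt_eqF.
Qed.

Lemma flat_ge0 k x : 0 <= flat k x.
Proof.
rewrite /flat; case: ifPn => // x0.
by rewrite mulr_ge0 ?expR_ge0// exprn_ge0// invr_ge0 ltW.
Qed.

(** From [exp y >= y ^+ k.+1 / k.+1`!] at [y = 1 / x]; this is what makes the
    functions flat at the origin. *)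
Lemma flat_le k x : flat k x <= k.+1`!%:R * `|x|.
Proof.
rewrite /flat; case: ifPn => x0; last by rewrite mulr_ge0.
rewrite (ger0_norm (ltW x0)) expRN.
rewrite ler_pdivrMr ?expR_gt0//.
have y0 : 0 < x^-1 by rewrite invr_gt0.
have /(ler_wpM2l (ltW x0)) := expR_ge1Dxn k (ltW y0).
rewrite mulrDr mulr1 => h.
have {}h : x * (x^-1 ^+ k.+1 / k.+1`!%:R) <= x * expR x^-1.
  by rewrite (le_trans _ h)// lerDr ltW.
have fk : 0 < k.+1`!%:R :> R by rewrite ltr0n fact_gt0.
rewrite exprS !mulrA mulfV ?gt_eqF// mul1r ler_pdivrMr// in h.
by rewrite (le_trans h)// mulrC mulrA.
Qed.

Lemma is_derive_flat k x :
  is_derive x 1 (flat k) (flat k.+2 x + (- k%:R) * flat k.+1 x).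
Proof.
have [x0|x0|->] := ltgtP x 0.
- rewrite /flat !ltNge !(ltW x0)/= mulr0 addr0.
  apply: (near_eq_is_derive (f := cst 0)).
  near=> z; rewrite /flat ltNge ltW//.
  by near: z; exact: lt_nbhsl.
- have xn0 : x != 0 by rewrite gt_eqF.
  have dV : is_derive x 1 (fun z : R => z^-1) (- x ^- 2).
    by have := @is_deriveV _ id x 1 1 xn0 (is_derive_id x 1);
      rewrite [_ *: _]mulr1.
  have dN : is_derive x 1 (fun z : R => - z^-1) (x ^- 2).
    by rewrite -[x ^- 2]opprK; exact: is_deriveN.
  have dE := @is_derive1_comp _ expR (fun z : R => - z^-1) x _ _
    (is_derive_expR (- x^-1)) dN.
  have dX : is_derive x 1 (fun z : R => z^-1 ^+ k)
      (k%:R * x^-1 ^+ k.-1 * (- x ^- 2)).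
    by have := is_deriveX k dV; rewrite exprfctE.
  have h := is_deriveM_real dX dE.
  have e : \forall z \near x, z^-1 ^+ k * expR (- z^-1) = flat k z.
    by near=> z; rewrite /flat ifT//; near: z; exact: lt_nbhsr.
  apply: (near_eq_is_derive e); apply: is_derive_eq h _.
  rewrite /flat x0 /comp -exprVn.
  by case: k {dX e} => [|k] /=; rewrite !exprS -?natr1; ring.
- have -> : flat k.+2 0 + - k%:R * flat k.+1 0 = flat k.+1 0.
    by rewrite /flat ltxx mulr0 addr0.
  apply/is_derive1_caratheodory; exists (flat k.+1); split => //.
    by move=> z; rewrite subr0 -flatS /flat ltxx subr0.
  have f0 : flat k.+1 0 = 0 by rewrite /flat ltxx.
  rewrite /prop_for /continuous_at f0.
  have c0 : (k.+2)`!%:R * `|x| @[x --> (0:R)] --> (0 : R).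
    rewrite -[X in _ --> X](mulr0 (k.+2)`!%:R) -[X in _ * X](normr0 R).
    by apply: cvgM; [exact: cvg_cst | apply: cvg_norm; exact: cvg_id].
  apply: squeeze_cvgr c0; last exact: cvg_cst.
  by near=> z; rewrite flat_ge0/= flat_le.
Unshelve. all: by end_near. Qed.

Lemma smooth_flat k : smooth (flat k).
Proof.
move=> n; elim: n k => [|n IHn] k; first exact: nderivable0 (is_derive_flat k).
by rewrite (nderivableS n (is_derive_flat k));
  apply: nderivableD => //; exact: nderivableZ.
Qed.

(** As [f] vanishes to the left of the origin, integrating from [-1] gives the
    right derivative on the whole line. *)
Lemma antiderivative f : continuous f -> (forall x, x <= 0 -> f x = 0) ->
  exists2 F : R -> R, forall x : R, is_derive x 1 F (f x) &
    forall x, x <= 0 -> F x = 0.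
Proof.
move=> cf f0; pose F x := \int[lebesgue_measure]_(t in `[-1, x]) f t.
have F0 x : x <= 0 -> F x = 0.
  move=> x0; rewrite /F (@eq_Rintegral _ _ _ _ _ (cst 0)).
    by rewrite Rintegral_cst// mul0r.
  move=> t; rewrite inE/= in_itv/= => /andP[_ tx].
  by rewrite f0// (le_trans tx).
exists F => // x; have [x0|x0] := ltP x 0.
  rewrite f0 ?(ltW x0)//; apply: (near_eq_is_derive (f := cst 0)).
  by near=> z; rewrite F0// ltW//; near: z; exact: lt_nbhsl.
have [] : derivable F x 1 /\ (F^`())%classic x = f x.
  apply: (@continuous_FTC1_closed R f (-1) x (x + 1)).
  - by rewrite ltrDl.
  - apply: continuous_compact_integrable; first exact: segment_compact.
    exact/continuous_subspaceT.
  - by rewrite (lt_le_trans _ x0)// ltrN10.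
  - exact: cf.
move: F {F0} => F dF <-; rewrite derive1E; exact: DeriveDef.
Unshelve. all: by end_near. Qed.

(** Obtained from a smooth bump by integrating twice: up to an additive constant
    on the right, a smoothing of [x |-> max 0 x] whose second derivative is a
    mollifier with support to the right of the origin. *)
Lemma smooth_ramp : exists S T r : R -> R,
  [/\ smooth S,
      forall x : R, is_derive x 1 S (T x) /\ is_derive x 1 T (r x),
      forall x, 0 <= r x /\ (~~ (0 < x < 1) -> r x = 0),
      forall x, 0 <= T x <= 1 /\ ((x <= 0 -> T x = 0) /\ (1 <= x -> T x = 1)) &
      forall x, (x <= 0 -> S x = 0) /\ (1 <= x -> S x = S 1 + (x - 1))].
Proof.
(* [exp (- 1 / x) * exp (- 1 / (1 - x))] on [0 < x < 1], zero elsewhere *)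
pose b x := flat 0 x * flat 0 (- 1 * x + 1).
have sb : smooth b by move=> n; apply: nderivableM;
  [exact: smooth_flat|exact: (smooth_affine _ _ (smooth_flat 0))].
have b_ge0 x : 0 <= b x by rewrite mulr_ge0// flat_ge0.
have b0 x : ~~ (0 < x < 1) -> b x = 0.
  rewrite negb_and -!leNgt /b /flat => /orP[x0|x1].
    by rewrite ltNge x0 mul0r.
  by rewrite [X in _ * X]ifF ?mulr0//; lra.
have b_gt0 x : 0 < x < 1 -> 0 < b x.
  move=> x01; rewrite /b /flat !ifT; [|lra..].
  by rewrite !expr0 !mul1r mulr_gt0 ?expR_gt0.
have cb := is_derive_continuous (nderivable_is_derive (sb 0%N)).
have [|T0 dT0 T00] := antiderivative cb.
  by move=> x x0; rewrite b0// negb_and -leNgt x0.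
have ndT0 x y : x <= y -> T0 x <= T0 y.
  move=> xy; have [z _ e] := MVT_real dT0 xy.
  by rewrite -subr_ge0 e mulr_ge0// subr_ge0.
have T01 x : 1 <= x -> T0 x = T0 1.
  move=> x1; have [z /andP[z1 _] e] := MVT_real dT0 x1.
  by apply/eqP; rewrite -subr_eq0 e b0 ?mul0r// negb_and -!leNgt z1 orbT.
have T1_gt0 : 0 < T0 1.
  have [] := @MVT R T0 b 0 1 ltr01 (fun x _ => dT0 x).
    exact/continuous_subspaceT/(is_derive_continuous dT0).
  by move=> z; rewrite in_itv/= (T00 0)// !subr0 mulr1 => /b_gt0 ? ->.
pose T x := (T0 1)^-1 * T0 x.
have dT x : is_derive x 1 T ((T0 1)^-1 * b x) by exact: is_deriveZ_real.
have [||S dS S0] := @antiderivative T.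
- exact: is_derive_continuous dT.
- by move=> x x0; rewrite /T (T00 x)// mulr0.
exists S, T, (fun x => (T0 1)^-1 * b x); split.
- apply/(smooth_is_derive dS)/(smooth_is_derive dT) => n.
  exact/nderivableZ/sb.
- by [].
- move=> x; split; first by rewrite mulr_ge0// invr_ge0 ltW.
  by move=> x01; rewrite b0 ?mulr0.
- move=> x; rewrite /T; split; last split.
  + have T0x : 0 <= T0 x.
      by have [/T00->//|/ltW/ndT0] := leP x 0; rewrite T00.
    have T0x1 : T0 x <= T0 1 by have [/ndT0//|/ltW/T01->] := leP x 1.
    by rewrite ler_pdivrMl// mulr1 T0x1 andbT mulr_ge0// invr_ge0 ltW.
  + by rewrite /T => /T00 ->; rewrite mulr0.
  + by rewrite /T => /T01 ->; rewrite mulVf// gt_eqF.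
- move=> x; split; first exact: S0.
  move=> x1; have [z /andP[z1 _] e] := MVT_real dS x1.
  have Tz : T z = 1 by rewrite /T T01// mulVf// gt_eqF.
  by rewrite Tz mul1r in e; rewrite -e; ring.
Qed.

End Smooth.

(** * Integrals over segments *)

Section SegmentIntegral.
Context {R : realType}.
Implicit Types (f g : R -> R) (x y z p q M : R).
Notation mu := (@lebesgue_measure R).

Lemma bounded_integrable f M x y : measurable_fun setT f ->
  (forall t, `|f t| <= M) -> mu.-integrable `[x, y] (EFin \o f).
Proof.
move=> mf fM; apply: measurable_bounded_integrable => //.
- by rewrite /= lebesgue_measure_itv/=; case: ifP => _; rewrite -?EFinB ltry.
- exact: measurable_funTS.
- exists M; split; first exact: num_real.
  by move=> N MN t _ /=; rewrite (le_trans (fM t))// ltW.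
Qed.

Lemma bounded_support_integrable f M p q : measurable_fun setT f ->
  (forall t, `|f t| <= M) -> (forall t, ~~ (p <= t <= q) -> f t = 0) ->
  mu.-integrable setT (EFin \o f) /\
  \int[mu]_t f t = \int[mu]_(t in `[p, q]) f t.
Proof.
move=> mf fM f0.
have e : f \_ `[p, q] = f.
  apply/funext => t; rewrite patchE mem_setE in_itv/=.
  by case: ifPn => // /f0.
split; last by rewrite [RHS]Rintegral_mkcond e.
rewrite -{1}e -restrict_EFin -integrable_mkcond//.
exact: bounded_integrable fM.
Qed.

Lemma itv_cc_cut f x y z : x <= y -> y <= z ->
  mu.-integrable `[x, z] (EFin \o f) ->
  \int[mu]_(t in `[x, z]) f t =
  \int[mu]_(t in `[x, y]) f t + \int[mu]_(t in `[y, z]) f t.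
Proof.
move=> xy yz fi; have := @Rintegral_itvB R f (BLeft x) (BRight z) y fi.
rewrite Rintegral_itv_obnd_cbnd; last first.
  apply: integrableS fi => // t /=; rewrite !in_itv/= => /andP[yt ->].
  by rewrite (le_trans xy)// ltW.
by rewrite !bnd_simp => /(_ xy yz)/eqP; rewrite subr_eq addrC => /eqP.
Qed.

Lemma continuous_integrable f x y : continuous f ->
  mu.-integrable `[x, y] (EFin \o f).
Proof.
move=> cf; apply: continuous_compact_integrable; first exact: segment_compact.
exact: continuous_subspaceT.
Qed.

Lemma FTC2_real f F x y : (forall t : R, is_derive t 1 F (f t)) ->
  continuous f -> x <= y -> \int[mu]_(t in `[x, y]) f t = F y - F x.
Proof.
move=> dF cf; rewrite le_eqVlt => /predU1P[->|xy].
  by rewrite set_itv1 Rintegral_set1 subrr.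
have cF := is_derive_continuous dF.
rewrite /Rintegral (@continuous_FTC2 _ f F)//.
- exact: continuous_subspaceT.
- split; first by move=> t _; have [] := dF t.
  + exact/cvg_at_right_filter/cF.
  + exact/cvg_at_left_filter/cF.
- by move=> t _; rewrite derive1E; have [_ ->] := dF t.
Qed.

Lemma normr_Rintegral_le (D : set R) f g : measurable D ->
  mu.-integrable D (EFin \o f) -> mu.-integrable D (EFin \o g) ->
  (forall t, D t -> `|f t| <= g t) ->
  `|\int[mu]_(t in D) f t| <= \int[mu]_(t in D) g t.
Proof.
move=> mD fi gi fg; apply: (le_trans (@le_normr_Rintegral _ _ R mu D f mD fi)).
by apply: (@le_Rintegral _ _ R mu) => //; exact: integrable_norm fi.
Qed.

Lemma integrable_subr (D : set R) f g : measurable D ->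
  mu.-integrable D (EFin \o f) -> mu.-integrable D (EFin \o g) ->
  mu.-integrable D (EFin \o (fun t => f t - g t)).
Proof. by move=> mD fi gi; exact: (@integrableB _ _ R mu D mD _ _ fi gi). Qed.

Lemma integrable_addr (D : set R) f g : measurable D ->
  mu.-integrable D (EFin \o f) -> mu.-integrable D (EFin \o g) ->
  mu.-integrable D (EFin \o (fun t => f t + g t)).
Proof. by move=> mD fi gi; exact: (@integrableD _ _ R mu D mD _ _ fi gi). Qed.

Lemma integrable_mulr (D : set R) f c : measurable D ->
  mu.-integrable D (EFin \o f) -> mu.-integrable D (EFin \o (fun t => c * f t)).
Proof. by move=> mD fi; exact: (@integrableZl _ _ R mu D mD c _ fi). Qed.

Lemma Rintegral_cst_itv M x y : x <= y ->
  \int[mu]_(t in `[x, y]) M = M * (y - x).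
Proof.
move=> xy; rewrite Rintegral_cst//= lebesgue_measure_itv/= lte_fin.
case: ltP => //= yx.
by rewrite (@le_anti _ _ x y) ?xy// subrr mulr0.
Qed.

End SegmentIntegral.

(** * From the weak equation to its integrated form *)

Section WeakToIntegral.
Context {R : realType}.
Implicit Types (f g h S T r : R -> R) (x y d e k M : R).
Notation mu := (@lebesgue_measure R).

(** [S] is a smoothing at scale [d] of [t |-> max 0 (t - x)], [T] one of the
    Heaviside step at [x], and [r] a mollifier supported just to the right of
    [x]. The smoothing shifts [S] on the right by [d * k], where [k] does not
    depend on [x]: a combination of ramps with weights that annihilate the
    affine functions then has compact support. *)
Record ramp k x d S T r : Prop := Ramp {
  ramp_smooth : smooth S ;
  ramp_S : forall t : R, is_derive t 1 S (T t) ;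
  ramp_T : forall t : R, is_derive t 1 T (r t) ;
  ramp_r_ge0 : forall t, 0 <= r t ;
  ramp_r0 : forall t, ~~ (x < t < x + d) -> r t = 0 ;
  ramp_T01 : forall t, 0 <= T t <= 1 ;
  ramp_T0 : forall t, t <= x -> T t = 0 ;
  ramp_T1 : forall t, x + d <= t -> T t = 1 ;
  ramp_S0 : forall t, t <= x -> S t = 0 ;
  ramp_S1 : forall t, x + d <= t -> S t = t - x + d * k }.

Lemma ramp_r_continuous k x d S T r : ramp k x d S T r -> continuous r.
Proof.
move=> p; have sr : smooth r.
  apply/(smooth_is_derive (ramp_T p))/(smooth_is_derive (ramp_S p)).
  exact: ramp_smooth p.
exact: is_derive_continuous (nderivable_is_derive (sr 0%N)).
Qed.

Lemma exists_ramp : exists k, forall x d, 0 < d ->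
  exists S T r, ramp k x d S T r.
Proof.
have [S [T [r [sS dS r01 T01 S01]]]] := @smooth_ramp R.
exists (S 1 - 1) => x d d0; pose s t := d^-1 * t + - (d^-1 * x).
have sE t : d * s t = t - x by rewrite /s mulrDr mulrN !mulVKf// gt_eqF.
have s_gt0 t : (0 < s t) = (x < t) by rewrite -(pmulr_rgt0 _ d0) sE subr_gt0.
have s_le0 t : (s t <= 0) = (t <= x) by rewrite !leNgt s_gt0.
have s_lt1 t : (s t < 1) = (t < x + d).
  by rewrite -(ltr_pM2l d0) sE mulr1 ltrBlDl.
have s_ge1 t : (1 <= s t) = (x + d <= t) by rewrite !leNgt s_lt1.
exists (fun t => d * S (s t)), (T \o s), (fun t => d^-1 * r (s t)).
split.
- move=> n; exact/nderivableZ/(smooth_affine _ _ sS).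
- move=> t; have [dSt _] := dS (s t).
  have := is_deriveZ_real d (is_derive_affine dSt).
  by rewrite [T _ * _]mulrC mulVKf// gt_eqF.
- move=> t; have [_ dTt] := dS (s t).
  by rewrite mulrC; exact: is_derive_affine dTt.
- by move=> t; have [r0 _] := r01 (s t); rewrite mulr_ge0// invr_ge0 ltW.
- move=> t xt; have [_ ->] := r01 (s t); first by rewrite mulr0.
  by rewrite s_gt0 s_lt1.
- by move=> t; have [] := T01 (s t).
- by move=> t; have [_ []] := T01 (s t); rewrite s_le0.
- by move=> t; have [_ []] := T01 (s t); rewrite s_ge1.
- move=> t; have [+ _] := S01 (s t).
  by rewrite s_le0 => /[apply] ->; rewrite mulr0.
- move=> t; have [_] := S01 (s t); rewrite s_ge1 => /[apply] ->.
  by rewrite -sE; ring.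
Qed.

Lemma Rintegral_mollify k x d S T r g M e : ramp k x d S T r -> 0 < d ->
  measurable_fun setT g -> (forall t, `|g t| <= M) ->
  (forall t, x < t < x + d -> `|g t - g x| <= e) ->
  mu.-integrable setT (EFin \o (fun t => g t * r t)) /\
  `|\int[mu]_t (g t * r t) - g x| <= e.
Proof.
move=> p d0 mg gM ge; have cr := ramp_r_continuous p.
have xd : x <= x + d by rewrite lerDl ltW.
have [t0 t0x rmax] := EVT_max xd (continuous_subspaceT cr).
have rM t : `|r t| <= r t0.
  rewrite ger0_norm ?(ramp_r_ge0 p)//.
  have [xt|xt] := boolP (x < t < x + d); last first.
    by rewrite (ramp_r0 p)// (ramp_r_ge0 p).
  by apply: rmax; move/andP: xt => [/ltW + /ltW]; rewrite in_itv/= => -> ->.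
have r0 t : ~~ (x <= t <= x + d) -> r t = 0.
  move=> xt; apply: (ramp_r0 p); apply: contra xt => /andP[/ltW-> /ltW->//].
have mr : measurable_fun setT r by exact: continuous_measurable_fun.
have [ri rE] := bounded_support_integrable mr rM r0.
have int_r : \int[mu]_t r t = 1.
  rewrite rE (FTC2_real (ramp_T p))// (ramp_T1 p)// (ramp_T0 p)// subr0//.
have [gri _] : mu.-integrable setT (EFin \o (fun t => g t * r t)) /\
  \int[mu]_t (g t * r t) = \int[mu]_(t in `[x, x + d]) (g t * r t).
  apply: (@bounded_support_integrable _ _ (M * r t0)).
  - exact: measurable_funM.
  - by move=> t; rewrite normrM ler_pM.
  - by move=> t /r0 ->; rewrite mulr0.
split=> //.
have gxri : mu.-integrable setT (EFin \o (fun t => g x * r t)).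
  exact: integrable_mulr ri.
have eri : mu.-integrable setT (EFin \o (fun t => e * r t)).
  exact: integrable_mulr ri.
have -> : \int[mu]_t (g t * r t) - g x = \int[mu]_t (g t * r t - g x * r t).
  by rewrite RintegralB// RintegralZl// int_r mulr1.
have -> : e = \int[mu]_t (e * r t) by rewrite RintegralZl// int_r mulr1.
apply: normr_Rintegral_le => //.
  exact: integrable_subr.
move=> t _; rewrite -mulrBl normrM (ger0_norm (ramp_r_ge0 p t)).
have [xt|xt] := boolP (x < t < x + d); last by rewrite (ramp_r0 p)// !mulr0.
by rewrite ler_wpM2r ?(ramp_r_ge0 p)// ge.
Qed.

(** [Tx - Ty] is the indicator of [[x, y]] smoothed at its two ends, so that the
    error is carried by two segments of length [d]. *)
Lemma Rintegral_smoothed_indicator k x y d Sx Tx rx Sy Ty ry h M :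
  ramp k x d Sx Tx rx -> ramp k y d Sy Ty ry -> x < y -> 0 < d ->
  measurable_fun setT h -> (forall t, `|h t| <= M) ->
  mu.-integrable setT (EFin \o (fun t => h t * (Tx t - Ty t))) /\
  `|\int[mu]_t (h t * (Tx t - Ty t)) - \int[mu]_(t in `[x, y]) h t|
    <= 2 * M * d.
Proof.
move=> px py xy d0 mh hM; have M0 : 0 <= M by exact: le_trans (hM 0).
have mT : measurable_fun setT (fun t => Tx t - Ty t).
  apply: measurable_funB; apply: continuous_measurable_fun.
    exact: is_derive_continuous (ramp_T px).
  exact: is_derive_continuous (ramp_T py).
have T1 t : `|Tx t - Ty t| <= 1.
  by have := ramp_T01 px t; have := ramp_T01 py t; rewrite ler_norml; lra.
have [hTi _] : mu.-integrable setT (EFin \o (fun t => h t * (Tx t - Ty t))) /\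
  \int[mu]_t (h t * (Tx t - Ty t)) =
  \int[mu]_(t in `[x, y + d]) (h t * (Tx t - Ty t)).
  apply: (@bounded_support_integrable _ _ (M * 1)).
  - exact: measurable_funM.
  - by move=> t; rewrite normrM ler_pM.
  - move=> t; rewrite negb_and -!ltNge => /orP[tx|ty].
      by rewrite (ramp_T0 px) ?ltW// (ramp_T0 py) ?subrr ?mulr0//; lra.
    by rewrite (ramp_T1 px) ?(ramp_T1 py) ?subrr ?mulr0//; lra.
split=> //.
have cut p q : mu.-integrable setT (EFin \o (cst M \_ `[p, q])).
  rewrite -restrict_EFin -integrable_mkcond//.
  by apply: continuous_integrable => ?; exact: cst_continuous.
have hi : mu.-integrable setT (EFin \o (h \_ `[x, y])).
  by rewrite -restrict_EFin -integrable_mkcond//; exact: bounded_integrable hM.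
rewrite [X in _ - X]Rintegral_mkcond -RintegralB//.
have -> : 2 * M * d = \int[mu]_t ((cst M \_ `[x, x + d]) t +
                                  (cst M \_ `[y, y + d]) t).
  rewrite RintegralD// -!Rintegral_mkcond.
  by rewrite (@Rintegral_cst_itv _ M) ?(@Rintegral_cst_itv _ M)//; lra.
apply: normr_Rintegral_le => //.
- exact: integrable_subr.
- exact: integrable_addr.
move=> t _; rewrite !patchE !mem_setE !in_itv/= -[point]/(0 : R).
have Tx0 := ramp_T0 px (t := t); have Tx1 := ramp_T1 px (t := t).
have Ty0 := ramp_T0 py (t := t); have Ty1 := ramp_T1 py (t := t).
have Tx01 := ramp_T01 px t; have Ty01 := ramp_T01 py t.
have bnd c : `|c| <= 1 -> `|h t * c| <= M.
  by move=> c1; rewrite -[M]mulr1 normrM ler_pM.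
have Mx0 : 0 <= if x <= t <= x + d then M else 0 by case: ifP.
have My0 : 0 <= if y <= t <= y + d then M else 0 by case: ifP.
have [xt|tx] := leP x t; last first.
  by rewrite Tx0 ?Ty0 ?subrr ?mulr0 ?subr0 ?normr0 ?add0r//; lra.
have [ty|yt] := leP t y => /=.
  rewrite Ty0// subr0 -[X in _ - X]mulr1 -mulrBr.
  have [txd|xdt] := leP t (x + d); last first.
    by rewrite Tx1 ?(ltW xdt)// subrr mulr0 normr0 add0r.
  by rewrite (le_trans (bnd _ _)) ?lerDl// ler_norml; lra.
rewrite subr0 (ltW yt)/=; have [tyd|ydt] := leP t (y + d).
  by rewrite (le_trans (bnd _ (T1 t)))// lerDr; case: ifP.
rewrite Tx1; last lra; rewrite Ty1; last lra.
by rewrite subrr mulr0 normr0 addr0; case: ifP.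
Qed.

Lemma right_continuous_le (g : R -> R) x e : right_continuous g -> 0 < e ->
  exists2 d, 0 < d & forall t, x < t < x + d -> `|g t - g x| <= e.
Proof.
move=> gr e0; have /cvgrPdist_le/(_ e e0) := gr x.
move=> -[d /= d0 hd]; exists d => // t /andP[xt txd].
rewrite distrC; apply: hd => //=.
by rewrite distrC ger0_norm ?subr_ge0 ?ltW// ltrBlDl.
Qed.

(** Testing the equation against a function whose second derivative concentrates
    at the four points [x], [y], [0], [1], with the weights that make it
    compactly supported, shows that the defect [g y - g x - 2 * \int h] is
    proportional to [y - x]. Mollifying to the right only is what makes the
    limit valid at each point, [g] being right-continuous. *)
Lemma weak_to_integral g h M : measurable_fun setT g -> measurable_fun setT h ->
  (forall t, `|g t| <= M) -> (forall t, `|h t| <= M) -> right_continuous g ->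
  (forall phi, test_function phi ->
     2^-1 * (\int[mu]_t (g t * (phi^`()^`())%classic t)) +
     \int[mu]_t (h t * (phi^`())%classic t) = 0) ->
  exists c, forall x y, x < y ->
    g y - g x = 2 * (\int[mu]_(t in `[x, y]) h t) + c * (y - x).
Proof.
move=> mg mh gM hM gr weak; have M0 : 0 <= M by exact: le_trans (hM 0).
pose I x y := \int[mu]_(t in `[x, y]) h t.
exists (g 1 - g 0 - 2 * I 0 1) => x y xy; pose w := y - x.
have w0 : 0 < w by rewrite subr_gt0.
suff: forall e, 0 < e -> `|2^-1 * (g x - g y) + I x y +
    w * (2^-1 * (g 1 - g 0) - I 0 1)| <= 2 * (1 + w) * e.
  move=> small; set Q := 2^-1 * (g x - g y) + I x y + _ in small.
  have : Q == 0.
    rewrite -normr_le0; apply/ler_addgt0Pr => e e0; rewrite add0r.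
    have w1 : 0 < 2 * (1 + w) by lra.
    have := small (e / (2 * (1 + w))) (divr_gt0 e0 w1).
    by rewrite mulrC mulfVK// gt_eqF.
  rewrite /Q -/(I x y) -/w => /eqP; lra.
move=> e e0.
have [k ramps] := exists_ramp.
have [dx dx0 gx] := right_continuous_le x gr e0.
have [dy dy0 gy] := right_continuous_le y gr e0.
have [d0 d00 g0] := right_continuous_le 0 gr e0.
have [d1 d10 g1] := right_continuous_le 1 gr e0.
have [d d_gt0 [ddx ddy dd0 dd1 dM]] : exists2 d, 0 < d &
    [/\ d <= dx, d <= dy, d <= d0, d <= d1 & 2 * M * d <= e].
  have M1 : 0 < 2 * M + 1 by lra.
  exists (Num.min (Num.min dx dy) (Num.min (Num.min d0 d1) (e / (2 * M + 1)))).
    by rewrite !lt_min dx0 dy0 d00 d10 divr_gt0.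
  set d := Num.min _ _; have : d <= d by [].
  rewrite {2}/d !le_min => /andP[/andP[-> ->] /andP[/andP[-> ->]]].
  rewrite ler_pdivlMr// => dM; split=> //.
  have : 0 < d by rewrite !lt_min dx0 dy0 d00 d10 divr_gt0.
  lra.
have [Sx [Tx [rx px]]] := ramps x d d_gt0.
have [Sy [Ty [ry py]]] := ramps y d d_gt0.
have [S0 [T0 [r0 p0]]] := ramps 0 d d_gt0.
have [S1 [T1 [r1 p1]]] := ramps 1 d d_gt0.
have {}gx t : x < t < x + d -> `|g t - g x| <= e.
  by move=> ?; apply: gx; lra.
have {}gy t : y < t < y + d -> `|g t - g y| <= e.
  by move=> ?; apply: gy; lra.
have {}g0 t : 0 < t < 0 + d -> `|g t - g 0| <= e.
  by move=> ?; apply: g0; lra.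
have {}g1 t : 1 < t < 1 + d -> `|g t - g 1| <= e.
  by move=> ?; apply: g1; lra.
have [gxi gxE] := Rintegral_mollify px d_gt0 mg gM gx.
have [gyi gyE] := Rintegral_mollify py d_gt0 mg gM gy.
have [g0i g0E] := Rintegral_mollify p0 d_gt0 mg gM g0.
have [g1i g1E] := Rintegral_mollify p1 d_gt0 mg gM g1.
have [hxyi hxyE] := Rintegral_smoothed_indicator px py xy d_gt0 mh hM.
have [h01i h01E] := Rintegral_smoothed_indicator p0 p1 ltr01 d_gt0 mh hM.
(* The weights [1], [-1], [w], [-w] at [x], [y], [1], [0] have sum zero and
   annihilate the identity. *)
pose phi t := Sx t + - 1 * Sy t + w * (S1 t + - 1 * S0 t).
pose psi t := Tx t + - 1 * Ty t + w * (T1 t + - 1 * T0 t).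
pose rho t := rx t + - 1 * ry t + w * (r1 t + - 1 * r0 t).
have dphi (t : R) : is_derive t 1 phi (psi t).
  by apply: is_deriveD_real;
    [apply: is_deriveD_real; last apply: is_deriveZ_real |
     apply/is_deriveZ_real/is_deriveD_real; last apply: is_deriveZ_real];
    apply: ramp_S; eassumption.
have dpsi (t : R) : is_derive t 1 psi (rho t).
  by apply: is_deriveD_real;
    [apply: is_deriveD_real; last apply: is_deriveZ_real |
     apply/is_deriveZ_real/is_deriveD_real; last apply: is_deriveZ_real];
    apply: ramp_T; eassumption.
have phi1 : (phi^`())%classic = psi.
  by apply/funext => t; rewrite derive1E; have [_ ->] := dphi t.
have psi1 : (psi^`())%classic = rho.
  by apply/funext => t; rewrite derive1E; have [_ ->] := dpsi t.
have sphi : smooth phi.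
  have [sx sy] := (ramp_smooth px, ramp_smooth py).
  have [s0 s1] := (ramp_smooth p0, ramp_smooth p1).
  by move=> n; apply: nderivableD;
    [|apply: nderivableZ]; apply: nderivableD => //; exact: nderivableZ.
have phi0 (t : R) : ~~ (Num.min x 0 <= t <= Num.max y 1 + d) -> phi t = 0.
  rewrite negb_and -!ltNge lt_min => /orP[/andP[/ltW tx /ltW t0]|].
    have ty := le_trans tx (ltW xy); have t1 := le_trans t0 ler01.
    rewrite /phi (ramp_S0 px tx) (ramp_S0 py ty) (ramp_S0 p0 t0).
    by rewrite (ramp_S0 p1 t1) !mulr0 !addr0 mulr0 addr0.
  have ym : y <= Num.max y 1 by rewrite le_max lexx.
  have m1 : 1 <= Num.max y 1 by rewrite le_max lexx orbT.
  have shift z : z <= Num.max y 1 -> Num.max y 1 + d < t -> z + d <= t.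
    by move=> zm /ltW; apply: le_trans; rewrite lerD2r.
  move=> td; have ty := shift y ym td; have t1 := shift 1 m1 td.
  have tx := shift x (le_trans (ltW xy) ym) td.
  have t0 := shift 0 (le_trans ler01 m1) td.
  rewrite /phi (ramp_S1 px tx) (ramp_S1 py ty) (ramp_S1 p0 t0) (ramp_S1 p1 t1).
  by rewrite /w; ring.
have tphi : test_function phi.
  split; first exact: smooth_derive1n.
  apply: (@subclosed_compact _ _ `[Num.min x 0, Num.max y 1 + d]).
  - exact: closed_closure.
  - exact: segment_compact.
  rewrite [X in _ `<=` X](closure_id _).1; last exact: itv_closed.
  apply: closure_subset => t /=; apply: contraNP => /negP.
  by rewrite in_itv/= => /phi0 ->.
have := weak _ tphi; rewrite phi1 psi1.
have -> : \int[mu]_t (g t * rho t) =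
   (\int[mu]_t (g t * rx t) - \int[mu]_t (g t * ry t)) +
   w * (\int[mu]_t (g t * r1 t) - \int[mu]_t (g t * r0 t)).
  rewrite -!RintegralB// -RintegralZl//; last exact: integrable_subr.
  rewrite -RintegralD//; last 2 first.
  - exact: integrable_subr.
  - by apply/integrable_mulr/integrable_subr.
  by congr Rintegral; apply/funext => t; rewrite /rho; ring.
have -> : \int[mu]_t (h t * psi t) =
   \int[mu]_t (h t * (Tx t - Ty t)) - w * \int[mu]_t (h t * (T0 t - T1 t)).
  rewrite -RintegralZl// -RintegralB//; last exact: integrable_mulr.
  by congr Rintegral; apply/funext => t; rewrite /psi; ring.
move: gxE gyE g0E g1E hxyE h01E; rewrite -/(I x y) -/(I 0 1) -/w.
move: (\int[mu]_t (g t * rx t)) (\int[mu]_t (g t * ry t))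
  (\int[mu]_t (g t * r0 t)) (\int[mu]_t (g t * r1 t))
  (\int[mu]_t (h t * (Tx t - Ty t))) (\int[mu]_t (h t * (T0 t - T1 t))).
move=> Gx Gy G0 G1 Hxy H01 gxE gyE g0E g1E hxyE h01E Q.
have -> : 2^-1 * (g x - g y) + I x y + w * (2^-1 * (g 1 - g 0) - I 0 1) =
  2^-1 * (g x - Gx) + 2^-1 * (Gy - g y) + (I x y - Hxy) +
  w * (2^-1 * (g 1 - G1) + 2^-1 * (G0 - g 0) + (H01 - I 0 1)).
  by apply/eqP; rewrite -subr_eq0 -[X in _ == X]Q; apply/eqP; field.
have half (z z' : R) : `|z' - z| <= e -> `|2^-1 * (z - z')| <= 2^-1 * e.
  by rewrite distrC => zz; rewrite normrM ger0_norm ?invr_ge0// ler_pM2l.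
have -> : 2 * (1 + w) * e =
  2^-1 * e + 2^-1 * e + e + w * (2^-1 * e + 2^-1 * e + e) by field.
have tri (p q z : R) : `|p| <= 2^-1 * e -> `|q| <= 2^-1 * e -> `|z| <= e ->
    `|p + q + z| <= 2^-1 * e + 2^-1 * e + e.
  by rewrite !ler_norml; lra.
rewrite (le_trans (ler_normD _ _))// lerD//.
  by apply: tri; [exact: half|apply: half; rewrite distrC|
    rewrite distrC (le_trans hxyE)].
rewrite normrM (ger0_norm (ltW w0)) ler_pM2l//.
by apply: tri; [exact: half|apply: half; rewrite distrC|
  rewrite (le_trans h01E)].
Qed.

End WeakToIntegral.

(** * Mean values and derivatives *)

Section MeanValue.
Context {R : realType}.
Implicit Types (f g h k C D : R -> R) (x y z m M : R).
Notation mu := (@lebesgue_measure R).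

(** The extreme values of [k] are used as bounds, then the intermediate value
    theorem. *)
Lemma IVT_sandwich k x y P Q : x <= y -> continuous k -> 0 <= Q ->
  (forall m, (forall z, x <= z <= y -> m <= k z) -> m * Q <= P) ->
  (forall M, (forall z, x <= z <= y -> k z <= M) -> P <= M * Q) ->
  exists2 z, x <= z <= y & P = k z * Q.
Proof.
move=> xy ck Q0 lo hi; have ckxy := @continuous_subspaceT _ _ `[x, y] _ ck.
have [z1 + kz1] := EVT_min xy ckxy; have [z2 + kz2] := EVT_max xy ckxy.
rewrite !in_itv/= => z2xy z1xy.
have {}lo : k z1 * Q <= P by apply: lo => z zxy; apply: kz1; rewrite in_itv.
have {}hi : P <= k z2 * Q by apply: hi => z zxy; apply: kz2; rewrite in_itv.
have [Q_eq0|Qn0] := eqVneq Q 0.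
  exists x; first by rewrite lexx.
  by move: lo hi; rewrite Q_eq0 !mulr0 => lo hi; apply/le_anti/andP.
have {Qn0}Q_gt0 : 0 < Q by rewrite lt0r Qn0.
suff [z zxy kz] : exists2 z, x <= z <= y & k z = P / Q.
  by exists z => //; rewrite kz mulfVK// gt_eqF.
have [z12|z21] := leP z1 z2.
- have [||z + kz] := @IVT R k z1 z2 (P / Q) z12.
  + exact: continuous_subspaceT.
  + by rewrite ge_min le_max !ler_pdivlMr// !ler_pdivrMr// lo hi ?orbT.
  by rewrite in_itv/= => zz; exists z => //; move: z1xy z2xy zz; lra.
- have [||z + kz] := @IVT R k z2 z1 (P / Q) (ltW z21).
  + exact: continuous_subspaceT.
  + by rewrite ge_min le_max !ler_pdivlMr// !ler_pdivrMr// lo hi ?orbT.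
  by rewrite in_itv/= => zz; exists z => //; move: z1xy z2xy zz; lra.
Qed.

Lemma Rintegral_mean_value f g k x y : x <= y -> continuous k ->
  mu.-integrable `[x, y] (EFin \o f) -> mu.-integrable `[x, y] (EFin \o g) ->
  (forall t, x <= t <= y -> 0 <= f t) ->
  (forall t, x <= t <= y -> g t = k t * f t) ->
  exists2 z, x <= z <= y &
    \int[mu]_(t in `[x, y]) g t = k z * \int[mu]_(t in `[x, y]) f t.
Proof.
move=> xy ck fi gi f0 gE; apply: IVT_sandwich => //.
- by apply: Rintegral_ge0 => t /=; rewrite in_itv; exact: f0.
- move=> m mk; rewrite -RintegralZl//; apply: le_Rintegral => //.
    exact: integrable_mulr.
  by move=> t /=; rewrite in_itv/= => xty; rewrite gE// ler_wpM2r ?f0 ?mk.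
- move=> m mk; rewrite -RintegralZl//; apply: le_Rintegral => //.
    exact: integrable_mulr.
  by move=> t /=; rewrite in_itv/= => xty; rewrite gE// ler_wpM2r ?f0 ?mk.
Qed.

(** The increments of [D] are those of [C] times a value of [k] in between:
    a form of [dD = k dC] that needs no differentiability of the inner
    functions through which [C] and [D] are composed. *)
Lemma mean_value_derive C D k c x : continuous k ->
  (forall x y, x <= y ->
    exists2 z, x <= z <= y & D y - D x = k z * (C y - C x)) ->
  is_derive x 1 C c -> is_derive x 1 D (k x * c).
Proof.
move=> ck mv /is_derive1_caratheodory[gC [CE gCx <-]].
have {}mv y : {z | `|z - x| <= `|y - x| & D y - D x = k z * (C y - C x)}.
  apply/cid2; have [xy|/ltW yx] := leP x y.
    have [z xzy e] := mv _ _ xy; exists z => //.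
    by rewrite !ger0_norm ?subr_ge0 ?lerD2r//; case/andP: xzy.
  have [z /andP[yz zx] e] := mv _ _ yx; exists z.
    by rewrite !ler0_norm ?subr_le0// !opprB lerD2l lerN2.
  by apply: oppr_inj; rewrite opprB e -mulrN opprB.
pose s y := s2val (mv y).
have sE y : D y - D x = k (s y) * (C y - C x) := s2valP' (mv y).
have sx y : `|s y - x| <= `|y - x| := s2valP (mv y).
have ssx : s x = x.
  apply/eqP; rewrite -subr_eq0 -normr_le0.
  by have := sx x; rewrite subrr normr0.
apply/is_derive1_caratheodory; exists (fun y => k (s y) * gC y); split.
- by move=> y; rewrite sE CE mulrA.
- apply: cvgM; last exact: gCx.
  have cs : s y @[y --> x] --> s x.
    rewrite ssx; apply/cvgrPdist_le => /= e e0; exists e => //= y.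
    by move=> /= yx; rewrite distrC (le_trans (sx y))// distrC ltW.
  exact: (continuous_cvg _ (ck (s x)) cs).
- by rewrite ssx.
Qed.

Lemma is_derive_ge0 f x c : {homo f : x y / x <= y} -> is_derive x 1 f c ->
  0 <= c.
Proof.
move=> nd /is_derive1_caratheodory[g [fE cg <-]].
rewrite leNgt; apply/negP => gx.
have : \forall z \near x, g z < 0 by exact: cvgr_lt cg _ gx.
move=> [d /= d0 /(_ (x + d / 2))/=].
rewrite opprD addrA subrr sub0r normrN ger0_norm ?divr_ge0 ?ltW//.
rewrite ltr_pdivrMr// ltr_pMr// ltr1n => /(_ isT) gneg.
have d2 : 0 < d / 2 by rewrite divr_gt0.
have fx : f x <= f (x + d / 2) by apply: nd; rewrite lerDl ltW.
have : g (x + d / 2) * (d / 2) < 0 by rewrite nmulr_rlt0.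
by have := fE (x + d / 2); rewrite addrAC subrr add0r => <-; lra.
Qed.

(** On a segment of length [L] where the slope is close to [l], the increment is
    close to [l * L], which no bound allows for large [L] unless [l = 0]. This
    determines the integration constant from the behaviour at infinity. *)
Lemma bounded_slope_eq0 g k l M : (forall t, `|g t| <= M) ->
  (forall x y, x <= y -> exists2 z, x <= z <= y & g y - g x = k z * (y - x)) ->
  (forall e L, 0 < e ->
    exists x, forall z, x <= z <= x + L -> `|k z - l| <= e) ->
  l = 0.
Proof.
move=> gM mv kl; apply/eqP/negPn/negP => l0.
have nl0 : 0 < `|l| by rewrite normr_gt0.
have M0 : 0 <= M by exact: le_trans (gM 0).
have L0 : 0 <= (4 * M + 2) / `|l| by rewrite divr_ge0//; lra.
(* over this length a slope of at least [`|l| / 2] makes an increment larger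
   than [2 * M] *)
have [x kx] := kl (`|l| / 2) ((4 * M + 2) / `|l|) (divr_gt0 nl0 (ltr0n _ 2)).
have [|z /kx kz e] := mv x (x + (4 * M + 2) / `|l|); first by rewrite lerDl.
have {}kz : `|l| / 2 <= `|k z|.
  have := ler_normD (k z) (l - k z); rewrite addrC subrK distrC; lra.
have : `|g (x + (4 * M + 2) / `|l|) - g x| <= 2 * M.
  by rewrite (le_trans (ler_normB _ _))// [2 * M]mulr_natl lerD.
rewrite e [x + _]addrC addrK normrM (ger0_norm L0) leNgt => /negP; apply.
apply: lt_le_trans (ler_wpM2r L0 kz).
have -> : `|l| / 2 * ((4 * M + 2) / `|l|) = 2 * M + 1.
  by field; rewrite gt_eqF.
by rewrite ltrDl.
Qed.

End MeanValue.

(** * From the differential equation back to the weak one *)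

Section ClassicalToWeak.
Context {R : realType}.
Implicit Types (f g h phi : R -> R).
Notation mu := (@lebesgue_measure R).

Lemma test_function_support phi : test_function phi ->
  exists K, forall t : R, K < `|t| -> phi t = 0.
Proof.
move=> [_ /compact_bounded[K [_ KB]]]; exists (K + 1) => t Kt.
apply/eqP/negPn/negP => phit.
have : closure [set x | phi x != 0] t by exact: subset_closure.
have KK : K < K + 1 by rewrite ltrDl.
by move=> /(KB _ KK) /=; rewrite leNgt Kt.
Qed.

Lemma derive1_eq0_outside f K : (forall t : R, K < `|t| -> f t = 0) ->
  forall t : R, K < `|t| -> (f^`())%classic t = 0.
Proof.
move=> f0 t Kt; rewrite derive1E.
have e : \forall s \near t, cst 0 s = f s.
  near=> s; rewrite f0//; near: s.
  exists (`|t| - K) => /=; first by rewrite subr_gt0.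
  by move=> y /=; have := ler_normD (t - y) y; rewrite subrK; lra.
have [_ ->] := near_eq_is_derive e (is_derive_cst 0 t 1).
by [].
Unshelve. all: by end_near. Qed.

(** Integration by parts on a segment that contains the support of [phi]. *)
Lemma classical_to_weak g h phi : (forall t : R, is_derive t 1 g (2 * h t)) ->
  continuous h -> test_function phi ->
  2^-1 * (\int[mu]_t (g t * (phi^`()^`())%classic t)) +
  \int[mu]_t (h t * (phi^`())%classic t) = 0.
Proof.
move=> dg ch tphi; have [K phi0] := test_function_support tphi.
have phi10 := derive1_eq0_outside phi0; have phi20 := derive1_eq0_outside phi10.
have [dphi _] := tphi.
set p1 := (phi^`())%classic in phi10 phi20 *.
set p2 := (p1^`())%classic in phi20 *.
have dp1 (t : R) : is_derive t 1 p1 (p2 t).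
  by rewrite /p2 derive1E; apply: DeriveDef => //; have := dphi 1%N t;
    rewrite derive1n1.
have cp2 : continuous p2.
  move=> t; apply/differentiable_continuous/derivable1_diffP.
  by have := dphi 2%N t; rewrite !derive1nS derive1n0.
have cp1 := is_derive_continuous dp1; have cg := is_derive_continuous dg.
have K0 : K < `|K| + 1 by rewrite (le_lt_trans (ler_norm K))// ltrDl.
have supp f : (forall t, K < `|t| -> f t = 0) ->
    \int[mu]_t f t = \int[mu]_(t in `[- (`|K| + 1), `|K| + 1]) f t.
  move=> f0; rewrite [RHS]Rintegral_mkcond; congr Rintegral.
  apply/funext => t; rewrite patchE mem_setE in_itv/= -ler_norml.
  by case: ifPn => //; rewrite -ltNge => Kt; rewrite f0// (lt_trans K0).
rewrite (supp (fun t => g t * p2 t)); last by move=> t /phi20 ->; rewrite mulr0.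
rewrite (supp (fun t => h t * p1 t)); last by move=> t /phi10 ->; rewrite mulr0.
have cgp : continuous (fun t => g t * p2 t).
  by move=> t; apply: cvgM; [exact: cg|exact: cp2].
have chp : continuous (fun t => h t * p1 t).
  by move=> t; apply: cvgM; [exact: ch|exact: cp1].
have KK : - (`|K| + 1) <= `|K| + 1 by rewrite lerNl; have := normr_ge0 K; lra.
rewrite -RintegralZl//; last exact: continuous_integrable.
rewrite -RintegralD//; last exact: continuous_integrable; last first.
  exact/integrable_mulr/continuous_integrable.
apply: (etrans (@FTC2_real _ (fun t => 2^-1 * (g t * p2 t) + h t * p1 t)
  (fun t => 2^-1 * (g t * p1 t)) _ _ _ _ KK)).
- move=> t; have := is_deriveZ_real 2^-1 (is_deriveM_real (dg t) (dp1 t)).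
  by move=> /is_derive_eq; apply; field.
- move=> t; apply: cvgD; last exact: chp.
  by apply: cvgM; [exact: cvg_cst|exact: cgp].
- rewrite !phi10 ?normrN ?(ger0_norm (addr_ge0 (normr_ge0 K) ler01))//.
  by rewrite !mulr0 subrr.
Qed.

End ClassicalToWeak.

(** * Primitives on the unit segment *)

Section UnitSegment.
Context {R : realType}.
Implicit Types (f F : R -> R) (u w x y : R).
Notation mu := (@lebesgue_measure R).

(** Projection on [[0, 1]], through which functions that are only known there
    become globally continuous. *)
Definition clamp01 x : R := Num.max 0 (Num.min x 1).

Lemma clamp01_bounds x : 0 <= clamp01 x <= 1.
Proof. by rewrite /clamp01 le_max lexx ge_max ler01 ge_min lexx orbT. Qed.

Lemma clamp01_id x : 0 <= x <= 1 -> clamp01 x = x.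
Proof. by move=> /andP[x0 x1]; rewrite /clamp01 min_l// max_r. Qed.

Lemma clamp01_continuous : continuous clamp01.
Proof.
move=> x; apply: (@continuous_max _ _ (cst 0) (fun x => Num.min x 1) x).
  exact: cvg_cst.
by apply: (@continuous_min _ _ id (cst 1) x); [exact: cvg_id|exact: cvg_cst].
Qed.

Lemma comp_clamp01_continuous f : {within `[0, 1], continuous f} ->
  continuous (f \o clamp01).
Proof.
move=> /subspace_continuousP cf x.
have cx : `[0, 1]%classic (clamp01 x) by rewrite /= in_itv/= clamp01_bounds.
apply: cvg_comp (cf _ cx) => P wP; have := clamp01_continuous wP.
apply: (@filterS _ (nbhs x)) => y /= yP.
by apply: yP; rewrite in_itv/= clamp01_bounds.
Qed.

Lemma comp_clamp01_bounded f : {within `[0, 1], continuous f} ->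
  exists M : R, forall x, `|f (clamp01 x)| <= M.
Proof.
move=> cf; have [u _ fu] := EVT_max ler01 cf; have [w _ fw] := EVT_min ler01 cf.
exists (`|f u| + `|f w|) => x; rewrite ler_norml.
have cx : clamp01 x \in `[0, 1] by rewrite in_itv/= clamp01_bounds.
have := fu _ cx; have := fw _ cx.
have := ler_norm (f u); have := ler_norm (- f w); rewrite normrN.
have := normr_ge0 (f u); have := normr_ge0 (f w); lra.
Qed.

Lemma unit_integrable f u w : {within `[0, 1], continuous f} ->
  0 <= u -> w <= 1 -> mu.-integrable `[u, w] (EFin \o f).
Proof.
move=> cf u0 w1; apply: (@integrableS _ _ _ mu `[0, 1]) => //.
  by move=> t /=; rewrite !in_itv/=; lra.
exact: continuous_compact_integrable (@segment_compact _ _ _) cf.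
Qed.

Lemma primitive_continuous f : {within `[0, 1], continuous f} ->
  {within `[0, 1], continuous (primitive f)}.
Proof.
by move=> cf; apply: (parameterized_integral_continuous ler01);
  exact: unit_integrable.
Qed.

Lemma primitive0 f : primitive f 0 = 0.
Proof. by rewrite /primitive set_itv1 Rintegral_set1. Qed.

Lemma primitiveB f u w : {within `[0, 1], continuous f} ->
  0 <= u -> u <= w -> w <= 1 ->
  primitive f w - primitive f u = \int[mu]_(t in `[u, w]) f t.
Proof.
move=> cf u0 uw w1; rewrite /primitive (itv_cc_cut u0 uw) 1?addrC ?addKr//.
exact: unit_integrable.
Qed.

End UnitSegment.

Section Cdf.
Context {R : realType}.
Implicit Types (f F : R -> R) (x y : R).

Lemma is_cdfP F : is_cdf F <->
  [/\ nondecreasing F, right_continuous F, F @ -oo --> (0 : R) &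
      F @ +oo --> (1 : R)].
Proof.
split=> [[G /funext ->]|[nd rc F0 F1]].
  split; [exact: cumulative_is_nondecreasing|
    exact: cumulative_is_right_continuous|exact: cumulativeNy|
    exact: cumulativey].
pose mC := isCumulative.Build R _ R F nd rc.
pose mB := isCumulativeBounded.Build R 0 1 F F0 F1.
pose G : cumulativeBounded (0 : R) (1 : R) := HB.pack F mC mB.
by exists G.
Qed.

Lemma is_cdf_bounds F x : is_cdf F -> 0 <= F x <= 1.
Proof.
move=> /is_cdfP[nd _ F0 F1]; rewrite !leNgt -negb_or; apply/negP => /orP[Fx|Fx].
- have [y []] : exists y, F x < F y /\ y <= x.
    apply: (@filter_ex _ (ninfty_nbhs R)); near=> y; split; near: y.
      exact: cvgr_gt F0 _ Fx.
    by apply: nbhs_ninfty_le; exact: num_real.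
  by move=> + /nd; rewrite ltNge => /negP.
- have [y []] : exists y, F y < F x /\ x <= y.
    apply: (@filter_ex _ (pinfty_nbhs R)); near=> y; split; near: y.
      exact: cvgr_lt F1 _ Fx.
    by apply: nbhs_pinfty_ge; exact: num_real.
  by move=> + /nd; rewrite ltNge => /negP.
Unshelve. all: by end_near. Qed.

Lemma clamp01_cdf F x : is_cdf F -> clamp01 (F x) = F x.
Proof. by move=> cF; rewrite clamp01_id// is_cdf_bounds. Qed.

Lemma comp_cdfE f F : is_cdf F -> f \o F = (f \o clamp01) \o F.
Proof. by move=> cF; apply/funext => x /=; rewrite clamp01_cdf. Qed.

Lemma comp_cdf_continuous f F : {within `[0, 1], continuous f} -> is_cdf F ->
  continuous F -> continuous (f \o F).
Proof.
move=> cf cF ctF; rewrite (comp_cdfE f cF) => x; apply: continuous_comp.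
  exact: ctF.
exact: comp_clamp01_continuous.
Qed.

End Cdf.

(** * Stationary solutions as solutions of an ordinary differential equation *)

Section Stationary.
Context {R : realType} (a b : R -> R).
Context (a_cont : {within `[0, 1], continuous a})
        (b_cont : {within `[0, 1], continuous b})
        (A_incr : forall u v : R, 0 <= u -> u < v -> v <= 1 ->
           primitive a u < primitive a v).
Implicit Types (F : R -> R) (u w x y : R).
Notation mu := (@lebesgue_measure R).
Notation A := (primitive a).
Notation B := (primitive b).

Lemma A_mono u w : 0 <= u -> u <= w -> w <= 1 -> A u <= A w.
Proof.
by move=> u0; rewrite le_eqVlt => /predU1P[->//|uw] w1; rewrite ltW ?A_incr.
Qed.

(** The integrated form of the stationary equation; [A \o F] is differentiable
    even though [F] need not be where [a] vanishes. *)
Definition classical_solution F := continuous F /\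
  forall x : R, is_derive x 1 (A \o F) (2 * B (F x)).

Let cA : continuous (A \o clamp01).
Proof. exact/comp_clamp01_continuous/primitive_continuous. Qed.

Let cB : continuous (B \o clamp01).
Proof. exact/comp_clamp01_continuous/primitive_continuous. Qed.

Lemma stationaryE F : stationary a b F <-> forall phi, test_function phi ->
  2^-1 * (\int[mu]_t ((A \o F) t * (phi^`()^`())%classic t)) +
  \int[mu]_t ((B \o F) t * (phi^`())%classic t) = 0.
Proof.
have NN (x y : R) : 2^-1 * - - x - - y = 2^-1 * x + y by rewrite !opprK.
by split=> h phi tphi; have := h phi tphi;
  [move/(etrans (esym (NN _ _)))|move/(etrans (NN _ _))].
Qed.

Lemma classical_stationary F : is_cdf F -> classical_solution F ->
  stationary_cdf a b F.
Proof.
move=> cF [ctF dF]; split=> //; apply/stationaryE => phi.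
apply: classical_to_weak => //.
by apply: comp_cdf_continuous => //; exact: primitive_continuous.
Qed.

(** Strict monotonicity of [A] transfers the continuity of [A \o F] to [F]. *)
Lemma continuous_cdf F : is_cdf F -> continuous (A \o F) -> continuous F.
Proof.
move=> cF cAF x; have [nd _ _ _] := (is_cdfP F).1 cF.
have F01 y : 0 <= F y <= 1 by exact: is_cdf_bounds.
have /andP[Fx0 Fx1] := F01 x.
apply/cvgrPdist_lt => e e0.
have up : \forall y \near x, F y < F x + e.
  have [Fe|Fe] := leP (F x + e) 1; last first.
    by near=> y; have := F01 y; lra.
  have h : A (F x) < A (F x + e) by apply: A_incr => //; rewrite ltrDl.
  have : \forall y \near x, A (F y) < A (F x + e) by exact: cvgr_lt (cAF x) _ h.
  apply: filterS => y; rewrite ltNge => /negP Ay.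
  rewrite ltNge; apply/negP => Fy.
  by apply: Ay; apply: A_mono => //; [lra|have := F01 y; lra].
have lo : \forall y \near x, F x - e < F y.
  have [Fe|Fe] := leP 0 (F x - e); last first.
    by near=> y; have := F01 y; lra.
  have h : A (F x - e) < A (F x) by apply: A_incr => //; rewrite gtrBl.
  have : \forall y \near x, A (F x - e) < A (F y) by exact: cvgr_gt (cAF x) _ h.
  apply: filterS => y; rewrite ltNge => /negP Ay.
  rewrite ltNge; apply/negP => Fy.
  by apply: Ay; apply: A_mono => //; [have := F01 y; lra|lra].
near=> y; rewrite ltr_norml.
have : F y < F x + e by near: y.
have : F x - e < F y by near: y.
lra.
Unshelve. all: by end_near. Qed.

(** The weak equation first gives [A \o F] a Lipschitz bound, hence the
    continuity of [F], and then a continuous derivative [2 * B (F x) + c]. This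
    tends to [2 * B 0 + c = c] and to [2 * B 1 + c] at the two infinities, and
    [A \o F] is bounded: both limits are zero. *)
Lemma stationary_classical F : stationary_cdf a b F ->
  classical_solution F /\ B 1 = 0.
Proof.
move=> [cF /stationaryE weak]; have [nd rc F0 F1] := (is_cdfP F).1 cF.
have eA := comp_cdfE (primitive a) cF; have eB := comp_cdfE (primitive b) cF.
have [MA AM] := comp_clamp01_bounded (primitive_continuous a_cont).
have [MB BM] := comp_clamp01_bounded (primitive_continuous b_cont).
have mF : measurable_fun setT F by exact: nondecreasing_measurable.
have mA : measurable_fun setT (A \o F).
  rewrite eA; apply: measurableT_comp => //.
  exact: continuous_measurable_fun.
have mB : measurable_fun setT (B \o F).
  rewrite eB; apply: measurableT_comp => //.
  exact: continuous_measurable_fun.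
have MA0 : 0 <= MA by exact: le_trans (AM 0).
have MB0 : 0 <= MB by exact: le_trans (BM 0).
have bA t : `|(A \o F) t| <= MA + MB by rewrite eA (le_trans (AM _))// lerDl.
have bB t : `|(B \o F) t| <= MA + MB by rewrite eB (le_trans (BM _))// lerDr.
have rcA : right_continuous (A \o F).
  by rewrite eA => x; exact: (cvg_comp _ _ (rc x) (@cA (F x))).
have [c AF] := weak_to_integral mA mB bA bB rcA weak.
have AF_bnd x y : x <= y ->
    `|A (F y) - A (F x)| <= (2 * (MA + MB) + `|c|) * (y - x).
  rewrite le_eqVlt => /predU1P[->|xy]; first by rewrite !subrr normr0 mulr0.
  have := AF _ _ xy => /= ->; rewrite (le_trans (ler_normD _ _))//.
  rewrite [X in _ <= X]mulrDl lerD//.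
    rewrite normrM ger0_norm// -mulrA ler_pM2l//.
    rewrite -(Rintegral_cst_itv _ (ltW xy)); apply: normr_Rintegral_le => //.
    - exact: bounded_integrable bB.
    - by apply: continuous_integrable => ?; exact: cst_continuous.
    - by move=> t _; exact: bB.
  by rewrite normrM [`|y - x|]ger0_norm// subr_ge0 ltW.
have ctF : continuous F.
  apply: continuous_cdf => // x.
  set K := 2 * (MA + MB) + `|c| in AF_bnd.
  have K0 : 0 <= K by rewrite /K addr_ge0// mulr_ge0// addr_ge0.
  apply/cvgrPdist_le => /= e e0; exists (e / (K + 1)) => /=.
    by rewrite divr_gt0//; lra.
  move=> y /=; rewrite ltr_pdivlMr; last lra.
  have bnd : `|A (F x) - A (F y)| <= K * `|x - y|.
    have [xy|/ltW yx] := leP x y.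
      rewrite distrC (le_trans (AF_bnd _ _ xy))// ler_wpM2l//.
      by rewrite distrC ler_norm.
    by rewrite (le_trans (AF_bnd _ _ yx))// ler_wpM2l// ler_norm.
  have := normr_ge0 (x - y); nra.
have cBoF : continuous (B \o F).
  by apply: comp_cdf_continuous => //; exact: primitive_continuous.
have cBF : continuous (fun t => 2 * B (F t) + c).
  move=> t; apply: cvgD; last exact: cvg_cst.
  by apply: cvgM; [exact: cvg_cst|exact: cBoF].
have mv x y : x <= y -> exists2 z, x <= z <= y &
    A (F y) - A (F x) = (2 * B (F z) + c) * (y - x).
  move=> xy.
  have [|||||z zxy e] :=
    @Rintegral_mean_value _ (cst 1) (B \o F) (B \o F) _ _ xy.
  - exact: cBoF.
  - by apply: continuous_integrable => ?; exact: cst_continuous.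
  - exact: bounded_integrable bB.
  - by [].
  - by move=> t _; rewrite mulr1.
  exists z => //; move: xy; rewrite le_eqVlt => /predU1P[->|xy].
    by rewrite !subrr mulr0.
  have := AF _ _ xy => /= ->; move: e => /= ->.
  by rewrite (Rintegral_cst_itv _ (ltW xy)); ring.
have Blim u : 0 <= u <= 1 -> (forall d : R, 0 < d -> forall L : R,
      exists x, forall z, x <= z <= x + L -> `|F z - u| < d) ->
    2 * B u + c = 0.
  move=> u01 Fu; apply: (bounded_slope_eq0 bA mv) => e L e0.
  have /cvgrPdist_le/(_ (e / 2)) := @cB u.
  rewrite divr_gt0// => /(_ isT) -[d /= d0 Bd].
  have [x Fx] := Fu d d0 L; exists x => z /Fx Fz.
  have := Bd (F z); rewrite /ball_/= distrC => /(_ Fz).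
  rewrite clamp01_id// clamp01_cdf// ler_pdivlMr// => Be.
  rewrite (_ : _ - _ = 2 * (B (F z) - B u)); last by ring.
  by rewrite normrM ger0_norm// mulrC distrC.
have c0 : c = 0.
  have := Blim 0; rewrite primitive0 mulr0 add0r lexx ler01; apply=> // d d0 L.
  have /cvgrPdist_lt/(_ d d0)[K [_ FK]] := F0.
  exists (K - `|L| - 1) => z zL; rewrite distrC; apply: FK => /=.
  by have := ler_norm L; lra.
have B1 : B 1 = 0.
  have := Blim 1; rewrite c0 addr0 lexx ler01 => h.
  have /eqP : 2 * B 1 = 0; last by rewrite mulf_eq0 pnatr_eq0/= => /eqP.
  apply: h => // d d0 L.
  have /cvgrPdist_lt/(_ d d0)[K [_ FK]] := F1.
  exists (K + 1) => z zL; rewrite distrC; apply: FK => /=; lra.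
split=> //; split=> // x.
have -> : 2 * B (F x) = (2 * B (F x) + c) * 1 by rewrite c0 addr0 mulr1.
exact: (mean_value_derive cBF mv (is_derive_id x 1)).
Qed.

Lemma cdf_surj F u : is_cdf F -> continuous F -> 0 < u < 1 ->
  exists x, F x = u.
Proof.
move=> cF ctF /andP[u0 u1]; have [nd _ F0 F1] := (is_cdfP F).1 cF.
have [x Fx] : exists x, F x < u.
  by apply: (@filter_ex _ (ninfty_nbhs R)); exact: cvgr_lt F0 _ u0.
have [y Fy] : exists y, u < F y.
  by apply: (@filter_ex _ (pinfty_nbhs R)); exact: cvgr_gt F1 _ u1.
have xy : x <= y by rewrite leNgt; apply/negP => /ltW /nd; lra.
have [||z _ <-] := @IVT R F x y u xy; last by exists z.
  exact: continuous_subspaceT.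
by rewrite ge_min le_max (ltW Fx) (ltW Fy) orbT.
Qed.

(** [A \o F] is nondecreasing with derivative [2 * B \o F], and [F] takes all
    the values between [0] and [1]. *)
Lemma stationary_B_ge0 F u : stationary_cdf a b F -> 0 <= u <= 1 -> 0 <= B u.
Proof.
move=> sF /andP[]; have [[ctF dF] B1] := stationary_classical sF.
rewrite le_eqVlt => /predU1P[<-|u0]; first by rewrite primitive0.
rewrite le_eqVlt => /predU1P[->|u1]; first by rewrite B1.
have [cF _] := sF; have [nd _ _ _] := (is_cdfP F).1 cF.
have [x Fx] := cdf_surj cF ctF (introT andP (conj u0 u1)).
have ndA : nondecreasing (A \o F).
  move=> s t /nd st /=; have /andP[Fs0 _] := is_cdf_bounds s cF.
  by have /andP[_ Ft1] := is_cdf_bounds t cF; exact: A_mono.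
have := is_derive_ge0 ndA (dF x).
by rewrite Fx pmulr_rge0.
Qed.

End Stationary.

(** * Inverses of increasing functions on the open unit segment *)

Section GeneralizedInverse.
Context {R : realType}.
Implicit Types (F G : R -> R) (u w x y : R).

(** [F] is the inverse of [G], extended by [0] and [1] beyond the range of [G].
    Comparing with the values of [G] determines [F] and yields at once its
    monotony, continuity and limits. *)
Definition generalized_inverse G F := forall x, 0 <= F x <= 1 /\
  forall u, 0 < u < 1 -> (u <= F x) = (G u <= x) /\ (F x <= u) = (x <= G u).

Definition increasing01 G :=
  forall u w, 0 < u -> u < w -> w < 1 -> G u < G w.

Lemma cvg_at_0 G : increasing01 G -> (G u)%:E @[u --> 0^'+] -->
  ereal_inf [set (G u)%:E | u in `]0, 1[].
Proof.
move=> Gi.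
apply: (@nondecreasing_at_right_cvge _ _ _ (BLeft 1)).
  by rewrite bnd_simp.
move=> u w; rewrite !in_itv/= => /andP[u0 u1] /andP[w0 w1].
by rewrite le_eqVlt => /predU1P[->//|uw]; rewrite lee_fin ltW ?Gi.
Qed.

Lemma cvg_at_1 G : increasing01 G -> (G u)%:E @[u --> 1^'-] -->
  ereal_sup [set (G u)%:E | u in `]0, 1[].
Proof.
move=> Gi; apply/cvg_at_leftNP.
have -> : [set (G u)%:E | u in `]0, 1[] = [set (G (- u))%:E | u in `]- 1, - 0[].
  apply/seteqP; split=> _ [u /= + <-] /=; rewrite ?in_itv/= ?oppr0 => u01;
  by exists (- u); rewrite ?opprK//= ?in_itv/= ?oppr0; move: u01; lra.
apply: (@nonincreasing_at_right_cvge _ _ _ (BLeft (- 0))).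
  by rewrite bnd_simp oppr0 ltrN10.
move=> u w; rewrite !in_itv/= oppr0 => /andP[u0 u1] /andP[w0 w1].
rewrite le_eqVlt => /predU1P[->//|uw]; rewrite lee_fin ltW// Gi//; lra.
Qed.

Lemma lim_at_0E G : increasing01 G ->
  lim_at_0 G = ereal_inf [set (G u)%:E | u in `]0, 1[].
Proof. by move=> /cvg_at_0/cvg_lim; apply. Qed.

Lemma lim_at_1E G : increasing01 G ->
  lim_at_1 G = ereal_sup [set (G u)%:E | u in `]0, 1[].
Proof. by move=> /cvg_at_1/cvg_lim; apply. Qed.

(** The inequality on the right is strict because the infimum of a strictly
    increasing function on an open interval is not attained. *)
Lemma le_lim_at_0 G x : increasing01 G ->
  (x%:E <= lim_at_0 G)%E <-> forall u, 0 < u < 1 -> x < G u.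
Proof.
move=> Gi; rewrite lim_at_0E//; split=> [xG u /andP[u0 u1]|xG].
  have u2 : 0 < u / 2 < u by rewrite divr_gt0//= ltr_pdivrMr// ltr_pMr// ltr1n.
  move: u2 => /andP[u20 u2u]; apply: le_lt_trans (Gi _ _ u20 u2u u1).
  rewrite -lee_fin (le_trans xG)//; apply: ereal_inf_lbound.
  by exists (u / 2) => //=; rewrite in_itv/=; lra.
apply: le_ereal_inf_tmp => _ [u /= + <-]; rewrite in_itv/= => /xG.
by rewrite lee_fin => /ltW.
Qed.

Lemma lim_at_1_le G x : increasing01 G ->
  (lim_at_1 G <= x%:E)%E <-> forall u, 0 < u < 1 -> G u < x.
Proof.
move=> Gi; rewrite lim_at_1E//; split=> [Gx u /andP[u0 u1]|Gx].
  apply: (lt_le_trans (Gi u ((u + 1) / 2) u0 _ _)); [lra..|].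
  rewrite -lee_fin (le_trans _ Gx)//; apply: ereal_sup_ubound.
  by exists ((u + 1) / 2) => //=; rewrite in_itv/=; lra.
apply: ge_ereal_sup => _ [u /= + <-]; rewrite in_itv/= => /Gx.
by rewrite lee_fin => /ltW.
Qed.

Lemma increasing01_inj G : increasing01 G ->
  {in `]0, 1[%classic &, injective G}.
Proof.
move=> Gi u w; rewrite !inE/= !in_itv/= => /andP[u0 u1] /andP[w0 w1] e.
by apply/eqP; rewrite eq_le !leNgt; apply/andP; split; apply/negP => lt;
  [have := Gi _ _ w0 lt u1|have := Gi _ _ u0 lt w1]; rewrite e ltxx.
Qed.

Lemma increasing01_mono G u w : increasing01 G -> 0 < u < 1 -> 0 < w < 1 ->
  (G u <= G w) = (u <= w).
Proof.
move=> Gi /andP[u0 u1] /andP[w0 w1]; apply/idP/idP.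
  by apply: contra_le => wu; exact: Gi.
by rewrite le_eqVlt => /predU1P[->//|uw]; rewrite ltW// Gi.
Qed.

Lemma extended_inverse_spec G : increasing01 G ->
  (forall u, 0 < u < 1 -> {for u, continuous G}) ->
  generalized_inverse G (extended_inverse G).
Proof.
move=> Gi cG x; rewrite /extended_inverse.
case: ifPn => [/(lim_at_1_le _ Gi) Gx|/negP Gx].
  split=> [|u u01]; first by rewrite ler01 lexx.
  have /andP[_ u1] := u01; have Gux := Gx _ u01.
  by rewrite (ltW u1) (ltW Gux) [1 <= u]leNgt u1 [x <= _]leNgt Gux; split.
case: ifPn => [/(le_lim_at_0 _ Gi) xG|/negP xG].
  split=> [|u u01]; first by rewrite ler01 lexx.
  have /andP[u0 _] := u01; have xGu := xG _ u01.
  by rewrite (ltW u0) (ltW xGu) [u <= 0]leNgt u0 [_ <= x]leNgt xGu; split.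
have [w w01 Gw] : exists2 w, 0 < w < 1 & G w = x.
  have [u1 u101 xG1] : exists2 u, 0 < u < 1 & x <= G u.
    apply: contra_notP Gx => Gx; apply/(lim_at_1_le _ Gi) => u u01.
    by rewrite ltNge; apply/negP => ?; apply: Gx; exists u.
  have [u0 u001 G0x] : exists2 u, 0 < u < 1 & G u <= x.
    apply: contra_notP xG => xG; apply/(le_lim_at_0 _ Gi) => u u01.
    by rewrite ltNge; apply/negP => ?; apply: xG; exists u.
  have u01 : u0 <= u1.
    by rewrite -(increasing01_mono Gi)// (le_trans G0x).
  have [||w + <-] := @IVT R G u0 u1 x u01.
  - apply: continuous_in_subspaceT => u; rewrite inE/= in_itv/= => uu.
    by apply: cG; move: u001 u101 uu; lra.
  - by rewrite ge_min le_max G0x xG1 orbT.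
  by rewrite in_itv/= => ww; exists w => //; move: u001 u101 ww; lra.
have -> : 'pinv_(fun=> 0) `]0, 1[ G x = w.
  by rewrite -Gw pinvKV ?inE//=; exact: increasing01_inj.
split=> [|u u01]; first by move: w01; lra.
by rewrite -Gw !increasing01_mono.
Qed.

Lemma generalized_inverse_unique G F1 F2 : generalized_inverse G F1 ->
  generalized_inverse G F2 -> F1 =1 F2.
Proof.
suff le F F' x : generalized_inverse G F -> generalized_inverse G F' ->
    F x <= F' x.
  by move=> g1 g2 x; apply/le_anti; rewrite !le.
move=> gF gF'; rewrite leNgt; apply/negP => lt.
have [F01 Fu] := gF x; have [F'01 F'u] := gF' x.
have u01 : 0 < (F x + F' x) / 2 < 1 by move: F01 F'01 lt; lra.
have [_ Fle] := Fu _ u01; have [_ F'le] := F'u _ u01.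
have : F' x <= (F x + F' x) / 2 by lra.
by rewrite F'le -Fle; lra.
Qed.

Lemma generalized_inverse_id G F u : generalized_inverse G F -> 0 < u < 1 ->
  F (G u) = u.
Proof.
move=> gF u01; have [_ /(_ u u01)[le ge]] := gF (G u).
by apply/le_anti; rewrite ge le lexx.
Qed.

Lemma generalized_inverse_inv G F x : generalized_inverse G F -> 0 < F x < 1 ->
  G (F x) = x.
Proof.
move=> gF Fx; have [_ /(_ _ Fx)[le ge]] := gF x.
by apply/le_anti; rewrite -le -ge lexx.
Qed.

Lemma generalized_inverse_shift G F c : generalized_inverse G F <->
  generalized_inverse (fun u => G u - c) (fun x => F (x + c)).
Proof.
split=> gF x.
  have [F01 Fu] := gF (x + c); split=> // u /Fu.
  by rewrite lerBlDr lerBrDr.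
have [] := gF (x - c); rewrite subrK => F01 Fu; split=> // u /Fu.
by rewrite !lerD2r.
Qed.

Lemma generalized_inverse_mono G F : generalized_inverse G F ->
  {homo F : x y / x <= y}.
Proof.
move=> gF x y xy; rewrite leNgt; apply/negP => lt.
have [Fx Fxu] := gF x; have [Fy Fyu] := gF y.
have u01 : 0 < (F x + F y) / 2 < 1 by move: Fx Fy lt; lra.
have [le _] := Fxu _ u01; have [le' _] := Fyu _ u01.
have : (F x + F y) / 2 <= F x by lra.
by rewrite le => /le_trans/(_ xy); rewrite -le'; lra.
Qed.

Lemma generalized_inverse_continuous G F : generalized_inverse G F ->
  continuous F.
Proof.
move=> gF x; have [F01 Fu] := gF x; apply/cvgrPdist_le => e e0.
have up : \forall y \near x, F y <= F x + e.
  have [Fe|Fe] := leP 1 (F x + e).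
    by near=> y; have [Fy _] := gF y; move: Fy; lra.
  have ue : 0 < F x + e < 1 by move: F01; lra.
  have : x < G (F x + e) by rewrite ltNge; have [<- _] := Fu _ ue; lra.
  move=> /lt_nbhsl; apply: filterS => y /ltW.
  by have [_ /(_ _ ue)[_ ->]] := gF y.
have lo : \forall y \near x, F x - e <= F y.
  have [Fe|Fe] := leP (F x - e) 0.
    by near=> y; have [Fy _] := gF y; move: Fy; lra.
  have ue : 0 < F x - e < 1 by move: F01; lra.
  have : G (F x - e) < x by rewrite ltNge; have [_ <-] := Fu _ ue; lra.
  move=> /lt_nbhsr; apply: filterS => y /ltW.
  by have [_ /(_ _ ue)[-> _]] := gF y.
near=> y; rewrite ler_norml.
have : F y <= F x + e by near: y.
have : F x - e <= F y by near: y.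
lra.
Unshelve. all: by end_near. Qed.

Lemma generalized_inverse_cdf G F : generalized_inverse G F -> is_cdf F.
Proof.
move=> gF; apply/is_cdfP; split.
- exact: generalized_inverse_mono gF.
- by apply: right_continuousW; exact: generalized_inverse_continuous gF.
- apply/cvgrPdist_le => e e0; have [d d01 de] : exists2 d, 0 < d < 1 & d <= e.
    exists (Num.min e (1 / 2)); last by rewrite ge_min lexx.
    by rewrite lt_min e0 gt_min; apply/andP; split; [lra|apply/orP; right; lra].
  near=> x; have [Fx /(_ _ d01)[_ Fd]] := gF x.
  rewrite sub0r normrN ger0_norm; last by case/andP: Fx.
  rewrite (le_trans _ de)// Fd; near: x.
  by apply: nbhs_ninfty_le; exact: num_real.
- apply/cvgrPdist_le => e e0; have [d d01 de] : exists2 d, 0 < d < 1 & d <= e.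
    exists (Num.min e (1 / 2)); last by rewrite ge_min lexx.
    by rewrite lt_min e0 gt_min; apply/andP; split; [lra|apply/orP; right; lra].
  have d1 : 0 < 1 - d < 1 by move: d01; lra.
  near=> x; have [Fx /(_ _ d1)[Fd _]] := gF x.
  rewrite ger0_norm; last by rewrite subr_ge0; case/andP: Fx.
  rewrite (le_trans _ de)// lerBlDr addrC -lerBlDr Fd; near: x.
  by apply: nbhs_pinfty_ge; exact: num_real.
Unshelve. all: by end_near. Qed.

End GeneralizedInverse.

(** * The ratio [a / (2 B)] *)

Section Ratio.
Context {R : realType} (a b : R -> R).
Context (a_cont : {within `[0, 1], continuous a})
        (b_cont : {within `[0, 1], continuous b})
        (a_ge0 : forall u : R, 0 <= u <= 1 -> 0 <= a u)
        (A_incr : forall u v : R, 0 <= u -> u < v -> v <= 1 ->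
           primitive a u < primitive a v).
Implicit Types (F : R -> R) (u w x y e : R).
Notation mu := (@lebesgue_measure R).
Notation A := (primitive a).
Notation B := (primitive b).
Notation ratio := (stationary_ratio a b).

(** The denominator [2 B], kept away from zero. *)
Definition cutoff e u : R := Num.max (2 * B (clamp01 u)) e.

Lemma cutoff_gt0 e u : 0 < e -> 0 < cutoff e u.
Proof. by move=> e0; rewrite /cutoff lt_max e0 orbT. Qed.

Lemma cutoff_continuous e : continuous (cutoff e).
Proof.
move=> u; apply: (@continuous_max _ _ (fun t => 2 * B (clamp01 t)) (cst e)).
  apply: cvgM; first exact: cvg_cst.
  exact/comp_clamp01_continuous/primitive_continuous.
exact: cvg_cst.
Qed.

Lemma cutoffV_continuous e : 0 < e -> continuous (fun u => (cutoff e u)^-1).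
Proof.
move=> e0 u; apply: cvgV; last exact: cutoff_continuous.
by rewrite gt_eqF// cutoff_gt0.
Qed.

Lemma cutoff_quotient_continuous e : 0 < e ->
  {within `[0, 1], continuous (fun u => a u / cutoff e u)}.
Proof.
move=> e0 u; apply: cvgM; first exact: a_cont.
exact: (continuous_subspaceT (cutoffV_continuous e0)).
Qed.

(** Along a solution [F], the primitive of [a / cutoff] has derivative
    [2 B(F) / cutoff(F)]: at most [1], and equal to [1] where the cutoff is
    inactive. *)
Lemma cutoff_increment F e x y : is_cdf F -> classical_solution a b F ->
  0 < e -> x <= y ->
  exists2 z, x <= z <= y &
    \int[mu]_(t in `[F x, F y]) (a t / cutoff e t) =
    (cutoff e (F z))^-1 * (2 * B (F z)) * (y - x).
Proof.
move=> cF [ctF dF] e0 xy; have [nd _ _ _] := (is_cdfP F).1 cF.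
have F01 t : 0 <= F t <= 1 by exact: is_cdf_bounds.
pose D := primitive (fun u => a u / cutoff e u) \o F.
have ck : continuous (fun t => (cutoff e (F t))^-1).
  by move=> t; apply: (@continuous_comp _ _ _ F (fun u => (cutoff e u)^-1));
    [exact: ctF|exact: cutoffV_continuous].
have mv s t : s <= t -> exists2 z, s <= z <= t &
    D t - D s = (cutoff e (F z))^-1 * ((A \o F) t - (A \o F) s).
  move=> st; have Fst := nd _ _ st.
  have /andP[Fs0 _] := F01 s; have /andP[_ Ft1] := F01 t.
  have [||||u /andP[Fsu uFt] e'] := @Rintegral_mean_value _ a
      (fun u => a u / cutoff e u) _ _ _ Fst (cutoffV_continuous e0).
  - exact: unit_integrable.
  - by apply: unit_integrable => //; exact: cutoff_quotient_continuous.
  - by move=> u /andP[su ut]; apply: a_ge0; lra.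
  - by move=> u _; rewrite mulrC.
  have [||z + Fz] := @IVT R F s t u st.
  - exact: continuous_subspaceT.
  - by rewrite ge_min le_max Fsu uFt orbT.
  rewrite in_itv/= => szt; exists z => //.
  rewrite /D/= (primitiveB _ Fs0 Fst Ft1)//; last first.
    exact: cutoff_quotient_continuous.
  by rewrite (primitiveB _ Fs0 Fst Ft1)// e' Fz.
have dD t := mean_value_derive ck mv (dF t).
have [z zxy e'] := MVT_real dD xy; exists z => //.
have /andP[Fx0 _] := F01 x; have /andP[_ Fy1] := F01 y.
rewrite -e' /D/= (primitiveB _ Fx0 (nd _ _ xy) Fy1)//.
exact: cutoff_quotient_continuous.
Qed.

Lemma ratio_neq0 u : B u != 0 -> ratio u = (a u / (2 * B u))%:E.
Proof.
by move=> Bu; rewrite /stationary_ratio inver mulf_eq0 pnatr_eq0/= (negbTE Bu).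
Qed.

Lemma ratio_eq0 u : B u = 0 -> ratio u = ((a u)%:E * +oo)%E.
Proof. by move=> B0; rewrite /stationary_ratio B0 mulr0 inve0. Qed.

Lemma ratio_ge0 u : 0 <= u <= 1 -> 0 <= B u -> (0 <= ratio u)%E.
Proof.
move=> u01 Bu; have [B0|Bn0] := eqVneq (B u) 0.
  by rewrite ratio_eq0// mule_ge0 ?lee_fin ?a_ge0.
by rewrite ratio_neq0// lee_fin divr_ge0 ?a_ge0// mulr_ge0.
Qed.

(** Where [B] vanishes, the cut quotients grow to [+oo] or stay zero: the
    convention for the ratio is the one that makes it their monotone limit. *)
Lemma cvg_cutoff_quotient u : 0 <= u <= 1 -> 0 <= B u ->
  (a u / cutoff (n.+1%:R^-1) u)%:E @[n --> \oo] --> ratio u.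
Proof.
move=> u01 Bu; have [B0|Bn0] := eqVneq (B u) 0.
  rewrite ratio_eq0//; have [a0|an0] := eqVneq (a u) 0.
    rewrite a0 mul0e; apply: cvg_near_cst; apply: nearW => n.
    by rewrite mul0r.
  have a_gt0 : 0 < a u by rewrite lt0r an0 a_ge0.
  rewrite gt0_muley ?lte_fin//; apply/cvgeryP.
  have -> : (fun n => a u / cutoff n.+1%:R^-1 u) = (fun n => n.+1%:R * a u).
    apply/funext => n; rewrite /cutoff clamp01_id// B0 mulr0 max_r//.
    by rewrite invrK mulrC.
  apply/cvgryPge => M; near=> n; rewrite -ler_pdivrMr//.
  rewrite (@le_trans _ _ n%:R)//; last by rewrite ler_nat.
  by near: n; exact: nbhs_infty_ger.
have B_gt0 : 0 < 2 * B u by rewrite mulr_gt0// lt0r Bn0.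
rewrite ratio_neq0//; apply: cvg_near_cst; near=> n.
rewrite /cutoff clamp01_id// max_l// ltW//.
by near: n; exact: (near_infty_natSinv_lt (PosNum B_gt0)).
Unshelve. all: by end_near. Qed.

Lemma cutoff_quotient_nondecreasing u : 0 <= u <= 1 ->
  nondecreasing_seq (fun n => (a u / cutoff n.+1%:R^-1 u)%:E).
Proof.
move=> u01 m n mn; rewrite lee_fin ler_wpM2l ?a_ge0//.
rewrite lef_pV2 ?posrE ?cutoff_gt0//.
by rewrite /cutoff ge_max !le_max lexx/= lef_pV2 ?posrE// ler_nat ltnS mn orbT.
Qed.

(** By monotone convergence: the integrals of the cut quotients over [[u, w]]
    are at most the length of the segment on which [F] goes from [u] to [w]. *)
Lemma ratio_integrable_itv F u w : stationary_cdf a b F -> 0 < u -> u < w ->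
  w < 1 -> mu.-integrable `[u, w] ratio.
Proof.
move=> sF u0 uw w1; have [cF _] := sF.
have [cl _] := stationary_classical a_cont b_cont A_incr sF.
have [nd _ _ _] := (is_cdfP F).1 cF.
have [x Fx] : exists x, F x = u by apply: cdf_surj (cl.1) _ => //; lra.
have [y Fy] : exists y, F y = w by apply: cdf_surj (cl.1) _ => //; lra.
have xy : x <= y by rewrite leNgt; apply/negP => /ltW /nd; rewrite Fx Fy; lra.
have itv01 t : `[u, w]%classic t -> 0 <= t <= 1 by rewrite /= in_itv/=; lra.
have B0 t : 0 <= t <= 1 -> 0 <= B t.
  exact: (stationary_B_ge0 a_cont b_cont A_incr sF).
pose g n t := (a t / cutoff n.+1%:R^-1 t)%:E.
have gi n : mu.-integrable `[u, w] (g n).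
  by apply: unit_integrable; [exact: cutoff_quotient_continuous|lra|lra].
have g_cvg t : `[u, w]%classic t -> g n t @[n --> \oo] --> ratio t.
  by move=> /itv01 t01; apply: cvg_cutoff_quotient => //; exact: B0.
have mg n : measurable_fun `[u, w] (g n) by exact: measurable_int (gi n).
have mr : measurable_fun `[u, w] ratio by exact: emeasurable_fun_cvg mg g_cvg.
apply/integrableP; split=> //.
have -> : (\int[mu]_(t in `[u, w]) `|ratio t| =
           \int[mu]_(t in `[u, w]) limn (g ^~ t))%E.
  apply: eq_integral => t; rewrite inE => ut; rewrite gee0_abs; last first.
    by apply: ratio_ge0; [exact: itv01|exact/B0/itv01].
  by apply/esym/cvg_lim => //; exact: g_cvg.
have g0 n t : `[u, w]%classic t -> (0 <= g n t)%E.
  move=> /itv01 t01; rewrite lee_fin divr_ge0 ?a_ge0//.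
  by rewrite ltW// cutoff_gt0.
have ndg t : `[u, w]%classic t -> nondecreasing_seq (g ^~ t).
  by move=> /itv01 t01; exact: cutoff_quotient_nondecreasing.
have muw : measurable (`[u, w] : set R) by [].
have := @cvg_monotone_convergence _ _ _ mu _ muw _ mg g0 ndg.
move=> gcvg; apply: (@le_lt_trans _ _ (y - x)%:E); last exact: ltry.
rewrite -(cvg_lim _ gcvg)//; apply: lime_le.
  by apply/cvg_ex; eexists; exact: gcvg.
apply: nearW => n.
have n0 : 0 < n.+1%:R^-1 :> R by [].
have [z _ e] := cutoff_increment cF cl n0 xy; rewrite Fx Fy /Rintegral in e.
rewrite -(fineK (integrable_fin_num _ (gi n)))// lee_fin [X in X <= _]e.
rewrite ler_piMl ?subr_ge0// mulrC ler_pdivrMr ?cutoff_gt0// mul1r.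
by rewrite /cutoff clamp01_cdf// le_max lexx.
Qed.

Lemma stationary_locally_integrable F : stationary_cdf a b F ->
  locally_integrable_ereal `]0, 1[ ratio.
Proof.
move=> sF K K01 cK; have mK : measurable K by exact: compact_measurable.
have [->|/set0P K0] := eqVneq K set0; first exact: integrable_set0.
have cid : {within K, continuous (@id R)}.
  by apply: continuous_subspaceT => ?; exact: cvg_id.
have [u + minu] := compact_EVT_min K0 cK cid.
have [w + maxw] := compact_EVT_max K0 cK cid.
rewrite !inE => /K01; rewrite /= in_itv/= => /andP[w0 w1].
move=> /K01; rewrite /= in_itv/= => /andP[u0 u1].
apply: (@integrableS _ _ _ mu `[u / 2, (w + 1) / 2]) => //.
  move=> t Kt; have tK : t \in K by rewrite inE.
  by rewrite /= in_itv/=; have := minu t tK; have := maxw t tK; lra.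
by apply: (ratio_integrable_itv sF); lra.
Qed.

End Ratio.

(** * The function [Psi] *)

Lemma fine_integrable (R : realType) (x y : R) (f : R -> \bar R) :
  (@lebesgue_measure R).-integrable `[x, y] f ->
  (@lebesgue_measure R).-integrable `[x, y] (EFin \o (fine \o f)) /\
  (\int[lebesgue_measure]_(t in `[x, y]) f t =
   (\int[lebesgue_measure]_(t in `[x, y]) fine (f t))%:E)%E.
Proof.
move=> fi; have mD : measurable (`[x, y] : set R) by [].
have mf : measurable_fun `[x, y] f by exact: measurable_int fi.
have mff : measurable_fun `[x, y] (EFin \o (fine \o f)).
  by apply/measurable_EFinP; exact: measurableT_comp.
have ffi : (@lebesgue_measure R).-integrable `[x, y] (EFin \o (fine \o f)).
  apply: le_integrable fi => // t _ /=; case: (f t) => //=.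
    by rewrite normr0 leey.
  by rewrite normr0 leey.
split=> //; rewrite /Rintegral fineK; last exact: integrable_fin_num ffi.
apply: ae_eq_integral => //.
have := @integrable_ae _ _ R lebesgue_measure _ mD f fi.
by apply: filterS => t /[apply] /= /fineK ->.
Qed.

Section PsiTheory.
Context {R : realType} (a b : R -> R).
Context (a_cont : {within `[0, 1], continuous a})
        (b_cont : {within `[0, 1], continuous b})
        (a_ge0 : forall u : R, 0 <= u <= 1 -> 0 <= a u)
        (A_incr : forall u v : R, 0 <= u -> u < v -> v <= 1 ->
           primitive a u < primitive a v)
        (cond : existence_condition a b).
Implicit Types (F : R -> R) (u w x y e : R).
Notation mu := (@lebesgue_measure R).
Notation A := (primitive a).
Notation B := (primitive b).
Notation ratio := (stationary_ratio a b).
Notation Psi := (Psi a b).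

Let B_ge0 u : 0 <= u <= 1 -> 0 <= B u.
Proof. by have [_ + _] := cond; exact. Qed.

(** The real-valued ratio, with the value [0] where [B] vanishes; this changes
    the integrand on a negligible set only. *)
Definition ratio_real u := a u / (2 * B u).

Lemma fine_ratio u : fine (ratio u) = ratio_real u.
Proof.
rewrite /ratio_real; have [B0|Bn0] := eqVneq (B u) 0; last first.
  by rewrite ratio_neq0.
rewrite ratio_eq0// B0 mulr0 invr0 mulr0; have [a0|a0|->] := ltrgt0P (a u).
- by rewrite gt0_muley ?lte_fin.
- by rewrite lt0_muley ?lte_fin.
- by rewrite mul0e.
Qed.

Lemma ratio_real_integrable u w : 0 < u -> w < 1 ->
  mu.-integrable `[u, w] (EFin \o ratio_real) /\
  (\int[mu]_(t in `[u, w]) ratio t =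
   (\int[mu]_(t in `[u, w]) ratio_real t)%:E)%E.
Proof.
move=> u0 w1; have [_ _ li] := cond.
have /fine_integrable[ri ->] : mu.-integrable `[u, w] ratio.
  apply: li; last exact: segment_compact.
  by move=> t /=; rewrite !in_itv/=; lra.
have rr : fine \o ratio = ratio_real by apply/funext => t /=; exact: fine_ratio.
by rewrite rr in ri; split=> //; rewrite -rr.
Qed.

Lemma ratio_real_ge0 u : 0 <= u <= 1 -> 0 <= ratio_real u.
Proof. by move=> u01; rewrite divr_ge0 ?a_ge0// mulr_ge0// B_ge0. Qed.

(** Integrability forces [a = 0] almost everywhere on the zeros of [B], so that
    [a] is [2 B] times the ratio almost everywhere. *)
Lemma A_increment u w : 0 < u -> u <= w -> w < 1 ->
  exists2 z, u <= z <= w &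
    A w - A u = 2 * B z * \int[mu]_(t in `[u, w]) ratio_real t.
Proof.
move=> u0 uw w1; have [ri _] := ratio_real_integrable u0 w1.
have in01 t : `[u, w]%classic t -> 0 <= t <= 1 by rewrite /= in_itv/=; lra.
pose k t := 2 * B (clamp01 t).
have ck : continuous k.
  move=> t; apply: cvgM; first exact: cvg_cst.
  exact/comp_clamp01_continuous/primitive_continuous.
have kB t : `[u, w]%classic t -> k t = 2 * B t.
  by move=> /in01 t01; rewrite /k clamp01_id.
have mD : measurable (`[u, w] : set R) by [].
have ai : mu.-integrable `[u, w] (EFin \o a).
  by apply: unit_integrable => //; lra.
have mr : measurable_fun `[u, w] ratio_real.
  by apply/measurable_EFinP; exact: measurable_int ri.
have mk : measurable_fun `[u, w] k.
  by apply: measurable_funTS; exact: continuous_measurable_fun.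
have mkr : measurable_fun `[u, w] (EFin \o (fun t => k t * ratio_real t)).
  by apply/measurable_EFinP; exact: measurable_funM.
have kr t : `[u, w]%classic t -> B t != 0 -> k t * ratio_real t = a t.
  move=> ut Bt; rewrite kB// /ratio_real mulrC mulfVK// mulf_neq0//.
have kr0 t : `[u, w]%classic t -> B t = 0 -> k t * ratio_real t = 0.
  by move=> ut Bt; rewrite kB// Bt mulr0 mul0r.
have kri : mu.-integrable `[u, w] (EFin \o (fun t => k t * ratio_real t)).
  apply: le_integrable ai => // t ut /=; rewrite lee_fin.
  have [/(kr0 t ut) ->|/(kr t ut) -> //] := eqVneq (B t) 0.
  by rewrite normr0.
have -> : A w - A u = \int[mu]_(t in `[u, w]) (k t * ratio_real t).
  rewrite primitiveB//; [|lra..]; congr fine.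
  apply: ae_eq_integral => //; first exact: measurable_int ai.
  have [_ _ li] := cond.
  have rat : mu.-integrable `[u, w] ratio.
    apply: li; last exact: segment_compact.
    by move=> t /=; rewrite !in_itv/=; lra.
  have := @integrable_ae _ _ R mu _ mD _ rat.
  apply: filterS => t /= + ut => /(_ ut) rt.
  have [Bt|Bt] := eqVneq (B t) 0; last by rewrite kr.
  rewrite kr0//; congr EFin; move: rt; rewrite ratio_eq0//.
  have := a_ge0 (in01 _ ut); rewrite le_eqVlt => /predU1P[<-//|at0].
  by rewrite gt0_muley ?lte_fin.
have [||z zuw ->] := Rintegral_mean_value uw ck ri kri.
- by move=> t ut; apply: ratio_real_ge0; apply: in01; rewrite /= in_itv.
- by [].
- by exists z => //; rewrite kB//= in_itv.
Qed.

Lemma PsiB u w : 0 < u -> u <= w -> w < 1 ->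
  Psi w - Psi u = \int[mu]_(t in `[u, w]) ratio_real t.
Proof.
move=> u0 uw w1.
have half1 : 2^-1 < 1 :> R by lra.
have half0 : 0 < 2^-1 :> R by lra.
have cut x y z : 0 < x -> x <= y -> y <= z -> z < 1 ->
    \int[mu]_(t in `[x, z]) ratio_real t =
    \int[mu]_(t in `[x, y]) ratio_real t + \int[mu]_(t in `[y, z]) ratio_real t.
  move=> x0 xy yz z1; apply: itv_cc_cut => //.
  by have [] := ratio_real_integrable x0 z1.
rewrite /Defs.Psi; case: (leP 2^-1 u) => hu; case: (leP 2^-1 w) => hw; try lra.
- have [_ ->] := ratio_real_integrable half0 w1.
  have [_ ->] := ratio_real_integrable half0 (le_lt_trans uw w1).
  by rewrite /= (cut 2^-1 u w)//; ring.
- have [_ ->] := ratio_real_integrable half0 w1.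
  have [_ ->] := ratio_real_integrable u0 half1.
  by rewrite /= (cut u 2^-1 w)//; [ring|lra].
- have [_ ->] := ratio_real_integrable (lt_le_trans u0 uw) half1.
  have [_ ->] := ratio_real_integrable u0 half1.
  by rewrite /= (cut u w 2^-1)//; [ring|lra].
Qed.

Lemma Psi_increment u w : 0 < u -> u <= w -> w < 1 ->
  exists2 z, u <= z <= w & A w - A u = 2 * B z * (Psi w - Psi u).
Proof.
move=> u0 uw w1; have [z zuw e] := A_increment u0 uw w1.
by exists z => //; rewrite PsiB.
Qed.

(** [Psi] inherits from [A] its strict monotonicity, through [Psi_increment]. *)
Lemma Psi_increasing : increasing01 Psi.
Proof.
move=> u w u0 uw w1; have [z _ e] := Psi_increment u0 (ltW uw) w1.
rewrite -subr_gt0 lt0r; apply/andP; split.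
  apply: contra_eqN e => /eqP ->; rewrite mulr0 subr_eq0 gt_eqF// A_incr//; lra.
rewrite (PsiB u0 (ltW uw) w1); apply: Rintegral_ge0 => t /=.
by rewrite in_itv/= => ut; apply: ratio_real_ge0; lra.
Qed.

Lemma Psi_continuous u : 0 < u < 1 -> {for u, continuous Psi}.
Proof.
move=> /andP[u0 u1].
have l0 : 0 < u / 2 by lra.
have r1 : (u + 1) / 2 < 1 by lra.
have [ri _] := ratio_real_integrable l0 r1.
have lr : u / 2 < (u + 1) / 2 by lra.
have /(continuous_within_itvP _ lr)[cP _ _] :=
  parameterized_integral_continuous (ltW lr) ri.
have /cP cu : u \in `](u / 2), ((u + 1) / 2)[ by rewrite in_itv/=; lra.
have e : {near u, (fun t => Psi (u / 2) +
    parameterized_integral mu (u / 2) t ratio_real) =1 Psi}.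
  near=> t; rewrite /parameterized_integral -PsiB//; first by ring.
  - by apply: ltW; near: t; apply: lt_nbhsr; lra.
  - by near: t; exact: lt_nbhsl.
rewrite /prop_for /continuous_at -(nbhs_singleton e).
apply: (cvg_trans (near_eq_cvg e)).
by apply: cvgD; [exact: cvg_cst|exact: cu].
Unshelve. all: by end_near. Qed.

End PsiTheory.

(** * Values of [Psi] at the end points *)

Section PsiEnds.
Context {R : realType} (a b : R -> R).
Context (a_cont : {within `[0, 1], continuous a})
        (b_cont : {within `[0, 1], continuous b})
        (a_ge0 : forall u : R, 0 <= u <= 1 -> 0 <= a u)
        (A_incr : forall u v : R, 0 <= u -> u < v -> v <= 1 ->
           primitive a u < primitive a v)
        (cond : existence_condition a b).
Implicit Types (u w x y : R).
Notation mu := (@lebesgue_measure R).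
Notation ratio := (stationary_ratio a b).
Notation Psi := (Psi a b).

Let ratio_itv u w : 0 < u -> w < 1 -> mu.-integrable `[u, w] ratio.
Proof.
move=> u0 w1; have [_ _ li] := cond; apply: li; last exact: segment_compact.
by move=> t /=; rewrite !in_itv/=; lra.
Qed.

Let Psi_incr : increasing01 Psi.
Proof. exact: Psi_increasing. Qed.

Let Psi_half : Psi 2^-1 = 0.
Proof. by rewrite /Defs.Psi lexx set_itv1 integral_set1. Qed.

Let ratio_pos t : 0 <= t <= 1 -> (0 <= ratio t)%E.
Proof.
by move=> t01; have [_ B0 _] := cond; apply: ratio_ge0 => //; exact: B0.
Qed.

(** The values at [0] and [1] are integrals over closed segments, recovered as
    limits by monotone convergence along segments inside [(0, 1)]. *)
Lemma Psi0_lim x : lim_at_0 Psi = x%:E -> Psi 0 = x.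
Proof.
move=> limx; pose u n : R := n.+2%:R^-1.
have u0 n : 0 < u n by rewrite invr_gt0.
have uh n : u n <= 2^-1 by rewrite lef_pV2 ?posrE// ler_nat.
pose K n := `[u n, 2^-1]%classic.
have KE : \bigcup_n K n = `]0, 2^-1]%classic.
  apply/seteqP; split=> [t [n _]|t]; rewrite /K/= ?in_itv/=.
    by have := u0 n; lra.
  move=> /andP[t0 th].
  have [n _ /(_ n (leqnn n))/= nt] := near_infty_natSinv_lt (PosNum t0).
  exists n => //=; rewrite /K/= in_itv/= th andbT (le_trans _ (ltW nt))//.
  by rewrite lef_pV2 ?posrE// ler_nat.
have mK n : measurable_fun (K n) ratio.
  by apply: measurable_int (ratio_itv (u0 n) _); lra.
have mKn n : measurable (K n) by exact: measurable_itv.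
have mr : measurable_fun (\bigcup_n K n) ratio by apply/measurable_fun_bigcup.
have ndK : nondecreasing_seq K.
  move=> m n mn; apply/subsetPset => t; rewrite /K/= !in_itv/= => /andP[ut ->].
  by rewrite andbT (le_trans _ ut)// lef_pV2 ?posrE// ler_nat !ltnS.
have K0 n t : K n t -> (0 <= ratio t)%E.
  rewrite /K/= in_itv/= => ut; apply: ratio_pos; have := u0 n; lra.
have cvgK : (\int[mu]_(t in K n) ratio t)%E @[n --> \oo] -->
    (\int[mu]_(t in \bigcup_n K n) ratio t)%E.
  exact: ge0_nondecreasing_set_cvg_integral.
rewrite KE in mr cvgK.
have : (\int[mu]_(t in K n) ratio t)%E @[n --> \oo] --> (- x)%:E.
  have -> : (fun n => \int[mu]_(t in K n) ratio t)%E =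
            (fun n => (- Psi (u n))%:E).
    apply/funext => n; have h1 : 2^-1 < 1 :> R by lra.
    have [_ ->] := ratio_real_integrable cond (u0 n) h1.
    by rewrite -(PsiB cond (u0 n) (uh n) h1) Psi_half sub0r.
  suff h : (Psi (u n))%:E @[n --> \oo] --> x%:E by exact: cvgeN h.
  have := cvg_at_0 Psi_incr; rewrite -lim_at_0E// limx => h.
  apply: ((cvge_at_rightP (EFin \o Psi) 0 x).1 h); split=> //.
  have -> : u = (fun n => (n + 1).+1%:R^-1) by apply/funext => n; rewrite addn1.
  by rewrite (cvg_shiftn 1 (fun n => n.+1%:R^-1 : R)); exact: cvg_harmonic.
move=> /cvg_lim e; rewrite /Defs.Psi leNgt invr_gt0 ltr0n/=.
by rewrite -integral_itv_obnd_cbnd// -(cvg_lim _ cvgK)// e//= opprK.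
Qed.

Lemma Psi1_lim x : lim_at_1 Psi = x%:E -> Psi 1 = x.
Proof.
move=> limx; pose u n : R := 1 - n.+2%:R^-1.
have inv_le n : n.+2%:R^-1 <= 2^-1 :> R by rewrite lef_pV2 ?posrE// ler_nat.
have u1 n : u n < 1 by rewrite ltrBlDr ltrDl invr_gt0.
have uh n : 2^-1 <= u n by rewrite /u; move: (_^-1) (inv_le n) => z; lra.
have h0 : 0 < 2^-1 :> R by rewrite invr_gt0.
pose K n := `[2^-1, u n]%classic.
have KE : \bigcup_n K n = `[2^-1, 1[%classic.
  apply/seteqP; split=> [t [n _]|t]; rewrite /K/= ?in_itv/=.
    by have := u1 n; lra.
  move=> /andP[th t1]; have t1' : 0 < 1 - t by rewrite subr_gt0.
  have [n _ /(_ n (leqnn n))/= nt] := near_infty_natSinv_lt (PosNum t1').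
  exists n => //=; rewrite /K/= in_itv/= th/=.
  have : n.+2%:R^-1 <= n.+1%:R^-1 :> R by rewrite lef_pV2 ?posrE// ler_nat.
  by rewrite /u; move: (n.+2%:R^-1) (n.+1%:R^-1) nt => z z'; lra.
have mK n : measurable_fun (K n) ratio.
  exact: measurable_int (ratio_itv h0 (u1 n)).
have mKn n : measurable (K n) by exact: measurable_itv.
have mr : measurable_fun (\bigcup_n K n) ratio by apply/measurable_fun_bigcup.
have ndK : nondecreasing_seq K.
  move=> m n mn; apply/subsetPset => t; rewrite /K/= !in_itv/=.
  move=> /andP[-> tu] /=.
  by rewrite (le_trans tu)// lerB// lef_pV2 ?posrE// ler_nat !ltnS.
have K0 n t : K n t -> (0 <= ratio t)%E.
  rewrite /K/= in_itv/= => ut; apply: ratio_pos; have := u1 n; lra.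
have cvgK : (\int[mu]_(t in K n) ratio t)%E @[n --> \oo] -->
    (\int[mu]_(t in \bigcup_n K n) ratio t)%E.
  exact: ge0_nondecreasing_set_cvg_integral.
rewrite KE in mr cvgK.
have : (\int[mu]_(t in K n) ratio t)%E @[n --> \oo] --> x%:E.
  have -> : (fun n => \int[mu]_(t in K n) ratio t)%E =
            (fun n => (Psi (u n))%:E).
    apply/funext => n.
    have [_ ->] := ratio_real_integrable cond h0 (u1 n).
    by rewrite -(PsiB cond h0 (uh n) (u1 n)) Psi_half subr0.
  have := cvg_at_1 Psi_incr; rewrite -lim_at_1E// limx => h.
  apply: ((cvge_at_leftP (EFin \o Psi) 1 x).1 h); split=> //.
  rewrite -[X in _ --> X]subr0; apply: cvgB; first exact: cvg_cst.
  have -> : (fun n => n.+2%:R^-1) = (fun n => (n + 1).+1%:R^-1 : R).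
    by apply/funext => n; rewrite addn1.
  by rewrite (cvg_shiftn 1 (fun n => n.+1%:R^-1 : R)); exact: cvg_harmonic.
move=> /cvg_lim e; rewrite /Defs.Psi ifT; last by lra.
by rewrite -integral_itv_bndo_bndc// -(cvg_lim _ cvgK)// e.
Qed.

End PsiEnds.

(** * Stationary distributions and the inverse of [Psi] *)

Section PsiSolutions.
Context {R : realType} (a b : R -> R).
Context (a_cont : {within `[0, 1], continuous a})
        (b_cont : {within `[0, 1], continuous b})
        (a_ge0 : forall u : R, 0 <= u <= 1 -> 0 <= a u)
        (A_incr : forall u v : R, 0 <= u -> u < v -> v <= 1 ->
           primitive a u < primitive a v)
        (cond : existence_condition a b).
Implicit Types (F : R -> R) (u w x y c : R).
Notation mu := (@lebesgue_measure R).
Notation A := (primitive a).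
Notation B := (primitive b).
Notation Psi := (Psi a b).

Lemma generalized_inverse_Psi c :
  generalized_inverse (fun u => Psi u - c)
    (fun x => extended_inverse Psi (x + c)).
Proof.
apply/(generalized_inverse_shift Psi (extended_inverse Psi) c).
by apply: extended_inverse_spec; [exact: Psi_increasing|exact: Psi_continuous].
Qed.

Lemma A_increment_closed p q M : 0 <= p -> p < q -> q <= 1 ->
  (forall u w, p < u -> u <= w -> w < q -> A w - A u <= M) -> A q - A p <= M.
Proof.
move=> p0 pq q1 AM; apply/ler_addgt0Pr => e e0.
have e2 : 0 < e / 2 by lra.
have cA := comp_clamp01_continuous (primitive_continuous a_cont).
have pE : (A \o clamp01) p = A p by rewrite /= clamp01_id//; lra.
have qE : (A \o clamp01) q = A q by rewrite /= clamp01_id//; lra.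
have /cvgrPdist_le/(_ _ e2) near_p := cvg_at_right_filter (@cA p).
have /cvgrPdist_le/(_ _ e2) near_q := cvg_at_left_filter (@cA q).
have pm : p < (p + q) / 2 by lra.
have mq : (p + q) / 2 < q by lra.
have [u [pu um Au]] :
    exists u, [/\ p < u, u < (p + q) / 2 & `|A p - A u| <= e / 2].
  apply: (@filter_ex _ p^'+); near=> u.
  have pu : p < u by near: u; exact: nbhs_right_gt.
  have um : u < (p + q) / 2 by near: u; exact: nbhs_right_lt.
  split=> //; rewrite -pE -[u in A u]clamp01_id; last by lra.
  by near: u.
have [w [wq mw Aw]] :
    exists w, [/\ w < q, (p + q) / 2 < w & `|A q - A w| <= e / 2].
  apply: (@filter_ex _ q^'-); near=> w.
  have wq : w < q by near: w; exact: nbhs_left_lt.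
  have mw : (p + q) / 2 < w by near: w; exact: nbhs_left_gt.
  split=> //; rewrite -qE -[w in A w]clamp01_id; last by lra.
  by near: w.
have uw : u <= w by lra.
have := AM u w pu uw wq; move: Au Aw; rewrite !ler_norml; lra.
Unshelve. all: by end_near. Qed.

(** Along [F], where [Psi \o F] is the identity up to a shift, the increment
    [A w - A u = 2 B (Psi w - Psi u)] says that [A \o F] has derivative
    [2 B \o F]. On a segment where [F] reaches [0] or [1], the minimum of
    [B \o F] is zero since [B 0 = B 1 = 0], so that only the upper bound is to
    be proved, and it follows from the inner increments by passing to the
    limit. *)
Lemma generalized_inverse_classical c F :
  generalized_inverse (fun u => Psi u - c) F -> classical_solution a b F.
Proof.
move=> gF; have cF := generalized_inverse_cdf gF.
have ctF := generalized_inverse_continuous gF.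
split=> //; have nd := generalized_inverse_mono gF.
have [B1 B_ge0 _] := cond.
have F01 x : 0 <= F x <= 1 by exact: is_cdf_bounds.
have cBF : continuous (fun x => 2 * B (F x)).
  move=> x; apply: cvgM; first exact: cvg_cst.
  exact: (comp_cdf_continuous (primitive_continuous b_cont) cF ctF).
have between x y u : F x <= u -> u <= F y -> 0 < u < 1 ->
    x <= Psi u - c /\ Psi u - c <= y.
  move=> xu uy u01; have [_ /(_ u u01)[_ <-]] := gF x.
  by have [_ /(_ u u01)[<- _]] := gF y.
suff mv x y : x <= y -> exists2 z, x <= z <= y &
    (A \o F) y - (A \o F) x = 2 * B (F z) * (y - x).
  move=> x; have -> : 2 * B (F x) = 2 * B (F x) * 1 by rewrite mulr1.
  exact: (mean_value_derive cBF mv (is_derive_id x 1)).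
move=> xy; have Fxy := nd _ _ xy.
have incr u w : F x <= u -> u <= w -> w <= F y -> 0 < u -> w < 1 ->
    exists2 z, x <= z <= y & A w - A u = 2 * B (F z) * (Psi w - Psi u).
  move=> xu uw wy u0 w1.
  have [v /andP[uv vw] e] := Psi_increment a_cont b_cont a_ge0 cond u0 uw w1.
  have v01 : 0 < v < 1 by lra.
  have [xv vy] := between x y v (le_trans xu uv) (le_trans vw wy) v01.
  exists (Psi v - c); first by rewrite xv.
  by rewrite (generalized_inverse_id gF v01).
apply: IVT_sandwich => //; first by rewrite subr_ge0.
- move=> m mB; have [m0|m0] := leP m 0.
    rewrite (@le_trans _ _ 0)//; first by rewrite mulr_le0_ge0// subr_ge0.
    have /andP[Fx0 _] := F01 x; have /andP[_ Fy1] := F01 y.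
    by rewrite subr_ge0; exact: (A_mono A_incr).
  have inside z : x <= z <= y -> 0 < F z < 1.
    move=> zxy; have Bz := lt_le_trans m0 (mB z zxy).
    have /andP[Fz0 Fz1] := F01 z.
    rewrite !lt_neqAle Fz0 Fz1 !andbT; apply/andP; split; apply/eqP => Fz.
      by move: Bz; rewrite -Fz primitive0 mulr0 ltxx.
    by move: Bz; rewrite Fz B1 mulr0 ltxx.
  have Fx : 0 < F x < 1 by apply: inside; rewrite lexx.
  have Fy : 0 < F y < 1 by apply: inside; rewrite lexx andbT.
  have [||z zxy ->] := incr (F x) (F y) (lexx _) Fxy (lexx _); [lra..|].
  have := generalized_inverse_inv gF Fx; have := generalized_inverse_inv gF Fy.
  move=> /= ey ex; rewrite (_ : Psi (F y) - Psi (F x) = y - x); last by lra.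
  by rewrite ler_wpM2r ?mB// subr_ge0.
- move=> M BM; have M0 : 0 <= M.
    by apply: le_trans (BM x _); rewrite ?lexx// mulr_ge0// B_ge0.
  move: Fxy; rewrite le_eqVlt => /predU1P[e|Fxy].
    by rewrite /= e subrr mulr_ge0// subr_ge0.
  have /andP[Fx0 _] := F01 x; have /andP[_ Fy1] := F01 y.
  apply: A_increment_closed => // u w xu uw wy.
  have u0 : 0 < u by lra.
  have w1 : w < 1 by lra.
  have [z zxy ->] := incr u w (ltW xu) uw (ltW wy) u0 w1.
  have u01 : 0 < u < 1 by lra.
  have w01 : 0 < w < 1 by lra.
  have uy : u <= F y by lra.
  have xw : F x <= w by lra.
  have [xu' _] := between x y u (ltW xu) uy u01.
  have [_ wy'] := between x y w xw (ltW wy) w01.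
  have Puw : 0 <= Psi w - Psi u.
    by rewrite subr_ge0 increasing01_mono//; exact: Psi_increasing.
  rewrite (le_trans (ler_wpM2r Puw (BM z zxy)))// ler_wpM2l//; lra.
Qed.

Lemma extended_inverse_stationary c :
  stationary_cdf a b (fun x => extended_inverse Psi (x + c)).
Proof.
have gF := generalized_inverse_Psi c.
apply: classical_stationary => //; first exact: generalized_inverse_cdf gF.
exact: generalized_inverse_classical gF.
Qed.

(** Between [F x] and [F y] the function [B] is bounded below by a positive
    constant; cutting [2 B] off at its minimum does nothing there, and
    [cutoff_increment] then holds with slope exactly [1]. *)
Lemma Psi_along_solution F x y : (forall u, 0 < u < 1 -> 0 < B u) ->
  stationary_cdf a b F -> x <= y -> 0 < F x -> F y < 1 ->
  Psi (F y) - Psi (F x) = y - x.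
Proof.
move=> B_gt0 sF xy Fx0 Fy1; have [cF _] := sF.
have [cl _] := stationary_classical a_cont b_cont A_incr sF.
have [nd _ _ _] := (is_cdfP F).1 cF; have Fxy := nd _ _ xy.
have cB := comp_clamp01_continuous (primitive_continuous b_cont).
have [v + Bv] := EVT_min Fxy (continuous_subspaceT cB).
rewrite in_itv/= => /andP[xv vy].
have in01 u : F x <= u -> u <= F y -> 0 < u < 1 by move=> xu uy; lra.
have e0 : 0 < 2 * B (clamp01 v).
  have /andP[v0 v1] := in01 v xv vy.
  by rewrite clamp01_id; [rewrite mulr_gt0// B_gt0// in01|lra].
have cut u : F x <= u -> u <= F y -> cutoff b (2 * B (clamp01 v)) u = 2 * B u.
  move=> xu uy; have /andP[u0 u1] := in01 u xu uy.
  rewrite /cutoff max_l; last first.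
    by rewrite ler_pM2l//; apply: Bv; rewrite in_itv/= xu.
  by rewrite clamp01_id//; lra.
have [z /andP[xz zy] e] := cutoff_increment a_cont b_cont a_ge0 cF cl e0 xy.
have [Fxz Fzy] := (nd _ _ xz, nd _ _ zy).
rewrite (PsiB cond Fx0 Fxy Fy1).
transitivity
  (\int[mu]_(t in `[F x, F y]) (a t / cutoff b (2 * B (clamp01 v)) t)).
  apply: eq_Rintegral => t; rewrite inE/= in_itv/= => /andP[xt ty].
  by rewrite /ratio_real cut.
rewrite e cut// mulVf ?mul1r// gt_eqF// mulr_gt0// B_gt0// in01//.
Qed.

Lemma stationary_extended_inverse F : (forall u, 0 < u < 1 -> 0 < B u) ->
  stationary_cdf a b F ->
  exists c, forall x, F x = extended_inverse Psi (x + c).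
Proof.
move=> B_gt0 sF; have [cF _] := sF.
have [[ctF _] _] := stationary_classical a_cont b_cont A_incr sF.
have [nd _ _ _] := (is_cdfP F).1 cF.
have half : 0 < (2^-1 : R) < 1 by lra.
have [x0 Fx0] := cdf_surj cF ctF half.
have PsiF y : 0 < F y < 1 -> Psi (F y) - (Psi (F x0) - x0) = y.
  move=> /andP[Fy0 Fy1].
  have [xy|/ltW yx] := leP x0 y.
    by have := Psi_along_solution B_gt0 sF xy; rewrite Fx0 => /(_ _ Fy1); lra.
  by have := Psi_along_solution B_gt0 sF yx Fy0; rewrite Fx0 => /(_ _); lra.
exists (Psi (F x0) - x0).
apply: generalized_inverse_unique (generalized_inverse_Psi _).
move=> x; split=> [|u u01]; first exact: is_cdf_bounds.
have [y Fy] := cdf_surj cF ctF u01; rewrite -Fy in u01 *.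
rewrite (PsiF y u01); split; apply/idP/idP; try exact: nd.
- apply: contra_le => xy; rewrite lt_neqAle nd ?ltW// andbT.
  apply: contraTneq xy => e; rewrite -leNgt -(PsiF y u01) -e PsiF ?e//.
- apply: contra_le => yx; rewrite lt_neqAle nd ?ltW// andbT.
  apply: contraTneq yx => e; rewrite -leNgt -(PsiF y u01) e PsiF -?e//.
Qed.

(** If [F 0 = 0], then [c] is below all the values of [Psi] on [(0, 1)], hence at
    most their limit at [0]; with the assumed converse inequality it is that
    limit, which is [Psi 0]. The case [F 0 = 1] is symmetric. *)
Lemma shift_eq_Psi c F : (forall x, F x = extended_inverse Psi (x + c)) ->
  (lim_at_0 Psi <= c%:E <= lim_at_1 Psi)%E -> c = Psi (F 0).
Proof.
move=> FE /andP[l0 l1].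
have Pi := Psi_increasing a_cont b_cont a_ge0 A_incr cond.
have gE : generalized_inverse Psi (extended_inverse Psi).
  by apply: extended_inverse_spec => //; exact: Psi_continuous.
rewrite FE add0r; have [E01 Eu] := gE c.
have [E0|E0] := eqVneq (extended_inverse Psi c) 0.
  rewrite E0; apply/esym/Psi0_lim => //; apply/le_anti; rewrite l0/=.
  rewrite lim_at_0E//; apply: le_ereal_inf_tmp => _ [u /= + <-].
  rewrite in_itv/= => u01; rewrite lee_fin; have [_ <-] := Eu u u01.
  by rewrite E0 ltW//; case/andP: u01.
have [E1|E1] := eqVneq (extended_inverse Psi c) 1.
  rewrite E1; apply/esym/Psi1_lim => //; apply/le_anti; rewrite l1 andbT.
  rewrite lim_at_1E//; apply: ge_ereal_sup => _ [u /= + <-].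
  rewrite in_itv/= => u01; rewrite lee_fin; have [<- _] := Eu u u01.
  by rewrite E1 ltW//; case/andP: u01.
apply/esym/(generalized_inverse_inv gE).
by move: E01; rewrite !lt_neqAle eq_sym E0 E1 !andTb.
Qed.

End PsiSolutions.

Theorem proposition3p1 (R : realType) (a b : R -> R)
  (a_cont : {within `[0, 1], continuous a})
  (b_cont : {within `[0, 1], continuous b})
  (a_ge0 : forall u : R, 0 <= u <= 1 -> 0 <= a u)
  (A_incr : forall u v : R, 0 <= u -> u < v -> v <= 1 ->
     primitive a u < primitive a v) :
  ((exists F : R -> R, stationary_cdf a b F) <-> existence_condition a b) /\
  (forall F : R -> R, stationary_cdf a b F -> continuous F) /\
  (existence_condition a b ->
   (forall u : R, 0 < u < 1 -> 0 < primitive b u) ->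
   forall F : R -> R,
     (stationary_cdf a b F <->
      exists xbar : R, forall x : R,
        F x = extended_inverse (Psi a b) (x + xbar)) /\
     (forall xbar : R,
        (forall x : R, F x = extended_inverse (Psi a b) (x + xbar)) ->
        (lim_at_0 (Psi a b) <= xbar%:E <= lim_at_1 (Psi a b))%E ->
        xbar = Psi a b (F 0))).
Proof.
have sufficient : existence_condition a b -> exists F, stationary_cdf a b F.
  move=> cond; exists (fun x => extended_inverse (Psi a b) (x + 0)).
  exact: extended_inverse_stationary.
split; last split.
- split=> [[F sF]|//].
  have [_ B1] := stationary_classical a_cont b_cont A_incr sF.
  split=> //.
    by move=> u; exact: (stationary_B_ge0 a_cont b_cont A_incr sF).
  exact: (stationary_locally_integrable a_cont b_cont a_ge0 A_incr sF).
- by move=> F sF; have [[]] := stationary_classical a_cont b_cont A_incr sF.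
- move=> cond B_gt0 F; split; last first.
    by move=> xbar FE; exact: shift_eq_Psi.
  split; first exact: stationary_extended_inverse.
  move=> [xbar FE].
  rewrite (_ : F = fun x => extended_inverse (Psi a b) (x + xbar)).
    exact: extended_inverse_stationary.
  exact/funext.
Qed.
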